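(* Let $\Gamma$ be a finitely generated marked group with Cayley graph $G=\mathrm{Cay}(\Gamma)$. The following are equivalent: (1) for every $\Gamma$-fiid labelling of $G$ (by a finite label set) there is an $\mathrm{Aut}(G)$-fiid labelling of $G$ with the same local statistics; (2) $G$ admits an $\mathrm{Aut}(G)$-fiid $\Gamma$-Cayley diagram. And the following are equivalent: (1* ) for every $\Gamma$-fiid labelling $\mathbf f$ of $G$ (by a finite label set), the local statistics of $\mathbf f$ are approximated by local statistics of $\mathrm{Aut}(G)$-fiid labellings, i.e. for every $r\in\mathbb N$ and $\varepsilon>0$ there is an $\mathrm{Aut}(G)$-fiid labelling whose radius-$r$ local statistics are within $\varepsilon$ in total variation of those of $\mathbf f$; (2* ) $G$ admits an $\mathrm{Aut}(G)$-fiid approximate $\Gamma$-Cayley diagram.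
   Context: A marked group is a group $\Gamma$ with a specified finite symmetric generating set $E$, with $e\notin E$. $\mathrm{Cay}(\Gamma)$ is the graph with vertex set $\Gamma$ and edge set $F=\{(x,\gamma x):x\in\Gamma,\gamma\in E\}$ (edges are ordered pairs). $\Gamma$ embeds into $\mathrm{Aut}(G)$ by $\gamma\mapsto\langle\gamma\rangle$, $\langle\gamma\rangle(x)=x\gamma^{-1}$. $\mathrm{Aut}(G)$ acts on $[0,1]^\Gamma$ and on spaces of vertex and/or edge labellings by shifting indices, $f\cdot x=x\circ f^{-1}$. For $K\in\{\Gamma,\mathrm{Aut}(G)\}$, a $K$-fiid labelling of $G$ with finite label set $A$ is a random labelling of vertices and/or edges given by a measurable map $\mathbf f$ from $([0,1]^\Gamma,\lambda^\Gamma)$ ($\lambda$ Lebesgue measure) to $A$-labellings of $G$ that is $K$-equivariant almost everywhere. Its radius-$r$ local statistics are the law of the isomorphism class of the rooted labelled graph $(B_r(e),e,\mathbf f\restriction B_r(e))$ (isomorphism as rooted, unmarked, labelled graphs); two labellings have the same local statistics if these laws agree for every $r$. A $\Gamma$-Cayley diagram on a graph with edge set $F$ is a map $c:F\to E$ such that (i) for every vertex $x$ and $\gamma\in E$ there is exactly one neighbour $y$ of $x$ with $c(x,y)=\gamma$; (ii) for every path $(x_0,\dots,x_n)$, $c(x_n,x_{n-1})\cdots c(x_1,x_0)=e$ iff $x_0=x_n$. The standard Cayley diagram of $\mathrm{Cay}(\Gamma)$ is $c_{st}(\gamma x,x)=\gamma$. An $\mathrm{Aut}(G)$-fiid Cayley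 diagram is an $\mathrm{Aut}(G)$-fiid edge labelling that is almost surely a Cayley diagram. An $\mathrm{Aut}(G)$-fiid approximate Cayley diagram is a sequence of $\mathrm{Aut}(G)$-fiid edge labellings $\mathbf f_i$ by elements of $E$ such that for every $r$, $\mathbb P\big((B_r(e),e,\mathbf f_i)\cong(B_r(e),e,c_{st})\big)\to1$. *)

(* Defs.v *)
From HB Require Import structures.
From mathcomp Require Import all_boot all_order all_algebra finmap.
From mathcomp Require Import all_classical all_reals all_analysis.

Set Implicit Arguments.
Unset Strict Implicit.
Unset Printing Implicit Defensive.

Import Order.TTheory GRing.Theory Num.Theory.
Import numFieldNormedType.Exports.

Local Open Scope classical_set_scope.

Record markedGroup := MarkedGroup {
  mg_group :> groupType;
  gens : {fset mg_group};
  gens_sym : forall g, g \in gens -> (g^-1)%g \in gens;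
  gens_gen : forall g, exists s : seq mg_group,
    {subset s <= gens} /\ g = (\prod_(h <- s) h)%g;
  gens_id : (1%g : mg_group) \notin gens }.

Section Graph.
Context {Gam : markedGroup}.
Local Open Scope group_scope.
Implicit Types x y : Gam.

(* (x, y) is an edge iff y = g x for some generator g. *)
Definition adj : rel Gam := fun x y => y * x^-1 \in gens Gam.

Lemma adj_sym x y : adj x y -> adj y x.
Proof. by move=> /gens_sym; rewrite invgM invgK. Qed.

Record aut := Aut {
  aut_fun :> Gam -> Gam;
  aut_inv : Gam -> Gam;
  aut_funK : cancel aut_fun aut_inv;
  aut_invK : cancel aut_inv aut_fun;
  aut_adj : forall x y, adj (aut_fun x) (aut_fun y) = adj x y }.

Lemma aut_inv_adj (f : aut) x y : adj (aut_inv f x) (aut_inv f y) = adj x y.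
Proof. by rewrite -(aut_adj f) !aut_invK. Qed.

Definition aut_inverse (f : aut) : aut :=
  Aut (aut_invK f) (aut_funK f) (aut_inv_adj f).

Lemma translateK (g : Gam) : cancel (fun x => x * g^-1) (fun x => x * g).
Proof. by move=> x; rewrite -mulgA mulVg mulg1. Qed.

Lemma translateVK (g : Gam) : cancel (fun x => x * g) (fun x => x * g^-1).
Proof. by move=> x; rewrite -mulgA mulgV mulg1. Qed.

Lemma translate_adj (g : Gam) x y : adj (x * g^-1) (y * g^-1) = adj x y.
Proof. by rewrite /adj invgM invgK -mulgA (mulgA g^-1) mulVg mul1g. Qed.

Definition translate (g : Gam) : aut :=
  Aut (translateK g) (translateVK g) (translate_adj g).

Definition GammaK : set aut := range translate.
Definition AutK : set aut := [set: aut].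

(* Labellings may label vertices, edges, or both.  The objects to be labelled
   are coded as pairs: the vertex x as (x, x), the edge from x to y as (x, y).
   There is no clash, because 1 is not a generator. *)
Inductive label_kind := Vertices | Edges | VerticesAndEdges.

Definition is_site (k : label_kind) (p : Gam * Gam) : bool :=
  match k with
  | Vertices => p.1 == p.2
  | Edges => adj p.1 p.2
  | VerticesAndEdges => (p.1 == p.2) || adj p.1 p.2
  end.

Definition site k := {p : Gam * Gam | is_site k p}.

Definition labelling k (A : Type) := site k -> A.

Lemma is_site_aut k (f : aut) p : is_site k p -> is_site k (f p.1, f p.2).
Proof. by case: k => /=; rewrite ?aut_adj ?(can_eq (aut_funK f)). Qed.

Definition site_act k (f : aut) (s : site k) : site k :=
  Sub (f (val s).1, f (val s).2) (is_site_aut f (valP s)).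

Definition lab_act k (A : Type) (f : aut) (l : labelling k A) :
  labelling k A := fun s => l (site_act (aut_inverse f) s).

Definition cball (r : nat) : set Gam :=
  [set x | exists p : seq Gam, [/\ path adj 1 p, last 1 p = x & (size p <= r)%N]].

(* (B_r(1), 1, l) and (B_r(1), 1, l') are isomorphic as rooted labelled graphs;
   B_r(1) is the subgraph induced on [cball r]. *)
Definition ball_iso k (A : Type) (r : nat) (l l' : labelling k A) : Prop :=
  exists phi : Gam -> Gam,
    [/\ set_bij (cball r) (cball r) phi,
        phi 1 = 1,
        {in cball r &, forall x y, adj (phi x) (phi y) = adj x y} &
        forall s t : site k, cball r (val s).1 -> cball r (val s).2 ->
          val t = (phi (val s).1, phi (val s).2) -> l' t = l s].

Definition iso_class k (A : Type) (r : nat) (l : labelling k A) :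
  set (labelling k A) := [set l' | ball_iso r l l'].

Definition edge_label (c : labelling Edges (gens Gam)) x y : Gam :=
  if insub (x, y) is Some s then val (c s) else 1.

(* word c x0 [:: x1; ...; xn] = c(xn, x(n-1)) * ... * c(x1, x0) *)
Fixpoint word (c : labelling Edges (gens Gam)) x (p : seq Gam) : Gam :=
  if p is y :: q then word c y q * edge_label c y x else 1.

Definition cayley_diagram (c : labelling Edges (gens Gam)) : Prop :=
  (forall x g, g \in gens Gam ->
     exists! y, adj x y /\ edge_label c x y = g) /\
  (forall x p, path adj x p -> (word c x p = 1 <-> x = last x p)).

(* c_st(g x, x) = g *)
Definition c_st : labelling Edges (gens Gam) :=
  fun s => FSetSub (adj_sym (valP s) : (val s).1 * (val s).2^-1 \in gens Gam).

End Graph.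

Arguments aut : clear implicits.
Arguments site : clear implicits.
Arguments labelling : clear implicits.

Definition unit_cube (R : realType) (Gam : markedGroup) : Type :=
  Gam -> {i01 R}.

HB.instance Definition _ R Gam := gen_eqMixin (unit_cube R Gam).
HB.instance Definition _ R Gam := gen_choiceMixin (unit_cube R Gam).
HB.instance Definition _ R Gam :=
  isPointed.Build (unit_cube R Gam) (fun=> 0%:i01%R).

(* The sigma-algebra of [0, 1] is the trace of the Borel sets of R. *)
Definition coord_sets (R : realType) (Gam : markedGroup) :
    set (set (unit_cube R Gam)) :=
  [set A | exists (v : Gam) (B : set R), measurable B /\
             A = [set x | B ((x v)%:num)%R]].

Arguments coord_sets : clear implicits.

Notation cube R Gam := (g_sigma_algebraType (coord_sets R Gam)).

Section Fiid.
Context {R : realType} {Gam : markedGroup}.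
Local Open Scope ereal_scope.

(* lam is the product measure on [0, 1]^Gam, the measure determined by its
   values on the finite-dimensional boxes. *)
Definition is_product_lebesgue (lam : probability (cube R Gam) R) : Prop :=
  forall (J : {fset Gam}) (B : Gam -> set R), (forall v, measurable (B v)) ->
    lam [set x | forall v, v \in J -> B v ((x v)%:num)%R] =
    \prod_(v <- J) lebesgue_measure (B v `&` `[0%R, 1%R]).

Definition cube_act (f : aut Gam) (x : cube R Gam) : cube R Gam :=
  fun v => x (aut_inv f v).

(* Measurability is for the product sigma-algebra, A being discrete. *)
Definition measurable_labelling k (A : Type)
    (F : cube R Gam -> labelling Gam k A) : Prop :=
  forall C : set (labelling Gam k A),
    <<s [set D | exists (s : site Gam k) (B : set A), D = [set l | B (l s)]] >> C ->
    measurable (F @^-1` C).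

Variable lam : probability (cube R Gam) R.

Definition fiid (K : set (aut Gam)) k (A : finType)
    (F : cube R Gam -> labelling Gam k A) : Prop :=
  measurable_labelling F /\
  forall f, K f -> {ae lam, forall x, F (cube_act f x) = lab_act f (F x)}.

(* The law of the isomorphism class of (B_r(1), 1, F), as a function of sets of
   isomorphism classes. *)
Definition local_stats k (A : finType) (r : nat)
    (F : cube R Gam -> labelling Gam k A) :
    set (set (labelling Gam k A)) -> \bar R :=
  fun C => lam [set x | C (iso_class r (F x))].

Definition same_local_stats k (A : finType)
    (F F' : cube R Gam -> labelling Gam k A) : Prop :=
  forall r, local_stats r F = local_stats r F'.

Definition tv_dist (T : Type) (mu nu : set T -> \bar R) : \bar R :=
  ereal_sup (range (fun C => `|mu C - nu C|)).

Definition has_fiid_cayley_diagram : Prop :=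
  exists c : cube R Gam -> labelling Gam Edges (gens Gam),
    fiid (@AutK Gam) c /\ {ae lam, forall x, cayley_diagram (c x)}.

Definition has_fiid_approx_cayley_diagram : Prop :=
  exists c : nat -> cube R Gam -> labelling Gam Edges (gens Gam),
    (forall i, fiid (@AutK Gam) (c i)) /\
    forall r, (fun i => lam [set x | ball_iso r (c i x) c_st]) @ \oo --> 1.

End Fiid.

(* Main.v *)
From HB Require Import structures.
Require Import Defs.
From mathcomp Require Import all_boot all_order all_algebra finmap.
From mathcomp Require Import all_classical all_reals all_analysis.
From mathcomp Require Import zify ring lra.

Set Implicit Arguments.
Unset Strict Implicit.
Unset Printing Implicit Defensive.

Import Order.TTheory GRing.Theory Num.Theory.
Import numFieldNormedType.Exports.

Local Open Scope classical_set_scope.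

(** A Cayley diagram c on the graph G gives every vertex v a canonical labelled
    isomorphism from the standard diagram to (G, c) that sends the root to v: the
    developing map of c at v, obtained by walking from v along the labels of c.
    Developing maps at different vertices differ by right translations, which is
    exactly the symmetry under which a Gamma-fiid labelling F is invariant.  So F
    can be transported to G: use half of the randomness at each vertex to produce
    c, pull the other half back to the group along the developing map at v, apply
    F, and give v and its edges the labels that F puts at the root.  This refers
    only to the graph, and is therefore Aut(G)-equivariant ([fiid_transfer]); and
    the invariance of F makes the readings from the different vertices fit together
    to a single image of F ([rule_error]).

    Conditionally on c, the developing map at the root is a fixed bijection and
    the second half of the randomness is still uniform, so that the point fed to F
    is again uniform ([law_random_cube_comp]).  The new labelling is the image of F
    at that point under a graph isomorphism fixing the root, and so it has the
    local statistics of F.  This uses that one uniform variable can be split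
    measurably into two independent ones, by dealing out its binary digits
    ([unif01_split], [halves_independent]).

    If c is only an approximate diagram, its developing maps are right on a large
    ball with high probability.  This is enough for labelling rules that look at a
    bounded part of the randomness, and every labelling with finitely many labels
    is close to such a rule ([measurable_approximable], [approximate_rule]).  Both
    cases are instances of one estimate, [transfer_stats], whose error terms are the
    probability that the development goes wrong and the probability that the rule
    differs from F; in the exact case both vanish.

    Conversely, the standard diagram is a constant Gamma-fiid labelling.  A
    labelling with its local statistics has standard balls around the root of every
    radius, almost surely, and the axioms of a Cayley diagram can be read off these
    balls ([cayley_diagram_of_balls]).  For approximations, take the i-th labelling
    to be 1 / (i + 1)-close at radius i. *)

(** * Splitting a uniform variable into two independent ones *)

(** Of each base-4 digit of q, [high_bits] keeps the leading binary digit and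
    [low_bits] the other one, so that the binary digits of q are dealt out
    alternately to two numbers of n digits. *)
Fixpoint high_bits n q :=
  if n is m.+1 then ((high_bits m (q %/ 4)).*2 + (q %% 4) %/ 2)%N else 0%N.

Fixpoint low_bits n q :=
  if n is m.+1 then ((low_bits m (q %/ 4)).*2 + q %% 2)%N else 0%N.

Lemma high_bits_lt n q : (high_bits n q < 2 ^ n)%N.
Proof.
elim: n q => [|n IH] q //=; have := IH (q %/ 4); rewrite expnS.
have : (q %% 4 < 4)%N by rewrite ltn_mod.
lia.
Qed.

Lemma low_bits_lt n q : (low_bits n q < 2 ^ n)%N.
Proof.
elim: n q => [|n IH] q //=; have := IH (q %/ 4); rewrite expnS.
lia.
Qed.

Lemma big_ord_mul (k n : nat) (F : nat -> nat) :
  (\sum_(i < k * n) F i = \sum_(q < n) \sum_(e < k) F (k * q + e))%N.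
Proof.
elim: n => [|n IH]; first by rewrite muln0 !big_ord0.
by rewrite mulnS addnC big_split_ord big_ord_recr IH.
Qed.

(** Dealing out the digits is a bijection from numbers below 4^n to pairs of
    numbers below 2^n.  Stated with arbitrary weights, this goes through an
    induction on n that merges the two values of a last digit into one weight. *)
Lemma sum_deinterleave n (f g : nat -> nat) :
  (\sum_(q < 4 ^ n) f (high_bits n q) * g (low_bits n q) =
   (\sum_(j < 2 ^ n) f j) * \sum_(k < 2 ^ n) g k)%N.
Proof.
elim: n f g => [|n IH] f g; first by rewrite !expn0 !big_ord1.
have pairs (h : nat -> nat) :
    (\sum_(j < 2 ^ n.+1) h j = \sum_(j < 2 ^ n) (h j.*2 + h j.*2.+1))%N.
  rewrite expnS big_ord_mul; apply: eq_bigr => j _.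
  by rewrite !big_ord_recr big_ord0 /= add0n mul2n addn0 addn1.
rewrite (pairs f) (pairs g).
rewrite -(IH (fun j => f j.*2 + f j.*2.+1)%N (fun j => g j.*2 + g j.*2.+1)%N).
rewrite expnS (big_ord_mul _ _ (fun q =>
  f (high_bits n.+1 q) * g (low_bits n.+1 q))%N).
apply: eq_bigr => q _.
rewrite !big_ord_recr big_ord0 /= add0n.
have quo e : (e < 4)%N -> ((4 * q + e) %/ 4 = q)%N by lia.
have rem e : (e < 4)%N -> ((4 * q + e) %% 4 = e)%N by lia.
have par e : ((4 * q + e) %% 2 = e %% 2)%N by lia.
rewrite !quo// !rem// !par /= !addn0 !addn1.
ring.
Qed.

Section UnitInterval.
Variable R : realType.
Local Open Scope ring_scope.
Implicit Types (A : set R) (B : nat).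

Lemma measurable_cells B (P : pred nat) : (0 < B)%N ->
  measurable [set x : R | P (Num.truncn (B%:R * x))].
Proof.
move=> B0; rewrite (_ : mkset _ =
    \bigcup_(q in [set q | P q]) [set x : R | Num.truncn (B%:R * x) = q]).
  apply: bigcup_measurable => q _.
  have le n : measurable [set x : R | (Num.truncn (B%:R * x) <= n)%N].
    rewrite (_ : mkset _ = `]-oo, (n.+1%:R / B%:R)[%classic); first exact: measurable_itv.
    apply/seteqP; split => x /=; rewrite truncn_le_nat in_itv /= ltr_pdivlMr ?ltr0n// mulrC//.
  case: q => [|q].
    by rewrite (_ : mkset _ = [set x : R | (Num.truncn (B%:R * x) <= 0)%N]);
      [exact: le|apply/seteqP; split => x /=; [move->|rewrite leqn0 => /eqP]].
  rewrite (_ : mkset _ = [set x : R | (Num.truncn (B%:R * x) <= q.+1)%N] `\`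
                         [set x : R | (Num.truncn (B%:R * x) <= q)%N]).
    by apply: measurableD; exact: le.
  apply/seteqP; split => x /=; first by move->; rewrite leqnn ltnn.
  by case=> + /negP; rewrite -ltnNge => ? ?; apply/eqP; rewrite eqn_leq; apply/andP.
by apply/seteqP; split => x /= => [?|[q Pq ->]//]; exists (Num.truncn (B%:R * x)).
Qed.

Lemma lebesgue_closed_unit A : measurable A ->
  lebesgue_measure (A `&` `[0, 1]) = lebesgue_measure (A `&` `[0, 1[).
Proof.
move=> mA; have mc : measurable (A `&` `[0, 1[%classic) by apply: measurableI.
rewrite -(@setUitv1 _ _ (BLeft 0) (1 : R) true) ?bnd_simp// setIUr measureU//.
- rewrite [X in (_ + X)%E](_ : _ = 0%E) ?adde0//; apply/eqP; rewrite eq_le measure_ge0 andbT.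
  by rewrite -(lebesgue_measure_set1 (1 : R)) le_measure ?inE//; exact: measurableI.
- exact: measurableI.
- by apply/seteqP; split => x //= [[_ +] [_ x1]]; rewrite x1 in_itv /= ltxx andbF.
Qed.

(** The unit interval falls into B cells of length 1 / B, on which the integer part
    of B x is constant; only x = 1, a null set, lies outside of them. *)
Lemma lebesgue_cells B (P : pred nat) : (0 < B)%N ->
  lebesgue_measure ([set x : R | P (Num.truncn (B%:R * x))] `&` `[0, 1]) =
  ((\sum_(q < B) P q)%N%:R / B%:R)%:E.
Proof.
move=> B0; have mP := measurable_cells P B0; have B0' : 0 < B%:R :> R by rewrite ltr0n.
rewrite lebesgue_closed_unit//.
suff step m : lebesgue_measure ([set x : R | P (Num.truncn (B%:R * x))] `&`
     `[0, m%:R / B%:R[) = ((\sum_(q < m) P q)%N%:R / B%:R)%:E.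
  by rewrite -step divff// gt_eqF.
elim: m => [|m IH].
  by rewrite mul0r set_itvco0 setI0 measure0 big_ord0 mul0r.
have le01 : m%:R / B%:R <= m.+1%:R / B%:R :> R by rewrite ler_pM2r ?invr_gt0// ler_nat.
rewrite (_ : `[0, m.+1%:R / B%:R[%classic =
  `[0, m%:R / B%:R[ `|` `[m%:R / B%:R, m.+1%:R / B%:R[); last first.
  have ge0 : 0 <= m%:R / B%:R :> R by rewrite divr_ge0.
  by apply: itv_bndbnd_setU; rewrite bnd_simp.
rewrite setIUr measureU.
- rewrite big_ord_recr /= natrD mulrDl EFinD -IH; congr (_ + _)%E.
  rewrite (_ : _ `&` _ = if P m then `[m%:R / B%:R, m.+1%:R / B%:R[%classic else set0).
    case: (P m); last by rewrite measure0 mul0r.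
    rewrite lebesgue_measure_itv /= lte_fin ltr_pM2r ?invr_gt0// ltr_nat ltnSn.
    by rewrite -EFinB -mulrBl -natrB// subSnn.
  have tr (x : R) : x \in `[m%:R / B%:R, m.+1%:R / B%:R[ -> Num.truncn (B%:R * x) = m.
    rewrite in_itv /= ler_pdivrMr// ltr_pdivlMr// mulrC => ?.
    exact: truncn_def.
  case: ifPn => Pm; apply/seteqP; split => x //=; first by case.
    by move=> /[dup] xm /tr ->.
  by move=> [+ /tr xm]; rewrite xm (negbTE Pm).
- exact: measurableI.
- exact: measurableI.
- apply/seteqP; split => x //= [[_]]; rewrite !in_itv/= => /andP[_ h1] [_ /andP[h2 _]].
  by move: (lt_le_trans h1 h2); rewrite ltxx.
Qed.
End UnitInterval.

Section Uniqueness.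
Local Open Scope ring_scope.
Local Open Scope ereal_scope.

Lemma finite_measure_unique d (T : measurableType d) (R : realType)
    (G : set (set T)) (m1 m2 : {measure set T -> \bar R}) :
  @measurable d T = <<s G >> -> setI_closed G ->
  m1 setT < +oo -> m1 setT = m2 setT -> (forall A, G A -> m1 A = m2 A) ->
  forall A, measurable A -> m1 A = m2 A.
Proof.
move=> mG GI fin eT eG A; rewrite mG => GA.
have subD : [set X | G X /\ X `<=` setT] = G.
  by apply/seteqP; split => X; [case|split].
apply: (@g_sigma_algebra_measure_unique_trace _ _ _ G setT) => //; rewrite ?subD//.
by rewrite mG; exact: sub_sigma_algebra.
Qed.

(** A product formula extends from two generating pi-systems to the
    sigma-algebras, one factor at a time: with the other event kept fixed, both
    sides are finite measures. *)
Lemma independent_of_pi_system d d1 d2 (T : measurableType d)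
    (T1 : measurableType d1) (T2 : measurableType d2) (R : realType)
    (mu : {finite_measure set T -> \bar R})
    (m1 : {finite_measure set T1 -> \bar R}) (m2 : {finite_measure set T2 -> \bar R})
    (f : T -> T1) (g : T -> T2) (G1 : set (set T1)) (G2 : set (set T2)) :
  measurable_fun setT f -> measurable_fun setT g ->
  @measurable d1 T1 = <<s G1 >> -> setI_closed G1 -> G1 setT ->
  @measurable d2 T2 = <<s G2 >> -> setI_closed G2 -> G2 setT ->
  (forall A B, G1 A -> G2 B -> mu (f @^-1` A `&` g @^-1` B) = m1 A * m2 B) ->
  forall A B, measurable A -> measurable B ->
    mu (f @^-1` A `&` g @^-1` B) = m1 A * m2 B.
Proof.
move=> mf mg mG1 G1I G1T mG2 G2I G2T eG.
have pre d' (T' : measurableType d') (h : T -> T') (mh : measurable_fun setT h) C :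
  measurable C -> measurable (h @^-1` C) by rewrite -[_ @^-1` _]setTI; exact: mh.
have nn d' (T' : measurableType d') (m : {finite_measure set T' -> \bar R}) C :
  measurable C -> ((0 <= fine (m C))%R * (m C = (fine (m C))%:E)).
  by move=> mC; rewrite fine_ge0// fineK// fin_num_measure.
have step1 A B : measurable A -> G2 B -> mu (f @^-1` A `&` g @^-1` B) = m1 A * m2 B.
  move=> mA GB.
  have mB : measurable B by rewrite mG2; exact: sub_sigma_algebra.
  have E := @finite_measure_unique _ _ _ G1
    (pushforward (mrestr mu (pre _ _ g mg B mB)) f)
    (mscale (NngNum (nn _ _ m2 _ mB).1) m1) mG1 G1I.
  have eqG A' : G1 A' -> mrestr mu (pre _ _ g mg B mB) (f @^-1` A') =
      mscale (NngNum (nn _ _ m2 _ mB).1) m1 A'.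
    by move=> GA'; rewrite /mscale /mrestr /= eG// muleC {1}(nn _ _ m2 _ mB).2.
  rewrite muleC (nn _ _ m2 _ mB).2; apply: E mA => //; last exact: eqG.
  rewrite /= /pushforward eqG// /mscale /= -(nn _ _ m2 _ mB).2 ltey_eq.
  by rewrite fin_numM ?fin_num_measure.
move=> A B mA mB.
have E := @finite_measure_unique _ _ _ G2
  (pushforward (mrestr mu (pre _ _ f mf A mA)) g)
  (mscale (NngNum (nn _ _ m1 _ mA).1) m2) mG2 G2I.
have eqG B' : G2 B' -> mrestr mu (pre _ _ f mf A mA) (g @^-1` B') =
    mscale (NngNum (nn _ _ m1 _ mA).1) m2 B'.
  by move=> GB'; rewrite /mscale /mrestr /= setIC step1// {1}(nn _ _ m1 _ mA).2.
rewrite setIC (nn _ _ m1 _ mA).2; apply: E mB => //; last exact: eqG.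
rewrite /= /pushforward eqG// /mscale /= -(nn _ _ m1 _ mA).2 ltey_eq.
by rewrite fin_numM ?fin_num_measure.
Qed.
End Uniqueness.

Section UniformSplitting.
Variable R : realType.
Local Open Scope ring_scope.

Let measurable01 : measurable (`[0, 1]%classic : set (measurableTypeR R)).
Proof. exact: measurable_itv. Qed.

Definition unif01 : set (measurableTypeR R) -> \bar R := mrestr lebesgue_measure measurable01.

HB.instance Definition _ :=
  Measure.copy unif01 (mrestr lebesgue_measure measurable01).

Let unif01T : unif01 setT = 1%E.
Proof.
by rewrite /unif01 /mrestr setTI lebesgue_measure_itv /= lte_fin ltr01 oppr0 adde0.
Qed.

HB.instance Definition _ := Measure_isProbability.Build _ _ _ unif01 unif01T.

Let digit_fun := (nat -> nat -> nat)%type.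

Definition approx_digits (B : nat) (b : digit_fun) n (x : R) : R :=
  (b n (Num.truncn ((B ^ n)%N%:R * x)))%:R / (2 ^ n)%N%:R.

(** The real number whose binary digits are the ones that b selects from the
    base-4 digits of x.  A supremum is used instead of a series because the
    events on which it exceeds a bound are then increasing unions. *)
Definition assemble_digits (b : digit_fun) (x : R) : R :=
  sup (range (approx_digits 4 b ^~ x)).

(** Refining x by one base-B digit appends one binary digit to the output; hence
    the approximations increase. *)
Let coherent (B : nat) (b : digit_fun) :=
  (forall n q, (b n (q %/ B)).*2 <= b n.+1 q)%N.

Lemma truncn_divn (B : nat) (x : R) : (0 < B)%N ->
  (Num.truncn (B%:R * x) %/ B = Num.truncn x)%N.
Proof.
move=> B0; have B0' : 0 < B%:R :> R by rewrite ltr0n.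
have [x0|x0] := ltP x 0.
  have tr0 (y : R) : y < 0 -> Num.truncn y = 0%N.
    by move=> y0; apply/truncn0Pn; rewrite -ltNge (lt_trans y0)// ltr01.
  by rewrite !tr0 ?div0n// pmulr_rlt0.
have /andP[] := truncn_itv (mulr_ge0 (ltW B0') x0).
set q := Num.truncn (B%:R * x) => lo hi; apply/esym/truncn_def.
rewrite -(ler_pM2l B0') -(ltr_pM2l B0' x) -!natrM ![(B * _)%N]mulnC.
rewrite (le_trans _ lo) ?ler_nat ?leq_divM//=.
by rewrite (lt_le_trans hi)// ler_nat ltn_ceil.
Qed.

Lemma approx_digits_nondecreasing B b (x : R) : (0 < B)%N -> coherent B b ->
  nondecreasing_seq (approx_digits B b ^~ x).
Proof.
move=> B0 cb; apply/nondecreasing_seqP => n; rewrite /approx_digits.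
rewrite ler_pdivrMr ?ltr0n ?expn_gt0// mulrAC ler_pdivlMr ?ltr0n ?expn_gt0//.
have := cb n (Num.truncn ((B ^ n.+1)%N%:R * x)).
rewrite [in X in (X <= _)%N]expnS natrM -mulrA truncn_divn// => h.
rewrite -!natrM ler_nat [in leqLHS]expnS mulnA leq_mul2r muln2 h orbT//.
Qed.

Lemma coherent_high : coherent 4 high_bits.
Proof. by move=> n q /=; exact: leq_addr. Qed.

Lemma coherent_low : coherent 4 low_bits.
Proof. by move=> n q /=; exact: leq_addr. Qed.

Lemma assemble_gt b (x s : R) : (forall n q, (b n q < 2 ^ n)%N) ->
  s < assemble_digits b x <-> exists n, s < approx_digits 4 b n x.
Proof.
move=> lb; have ne : range (approx_digits 4 b ^~ x) !=set0 by exists (approx_digits 4 b 0 x), 0%N.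
have ub : ubound (range (approx_digits 4 b ^~ x)) 1.
  move=> _ [n _ <-]; rewrite /approx_digits ler_pdivrMr ?ltr0n ?expn_gt0// mul1r.
  by rewrite ler_nat ltnW.
split=> [/sup_gt|[n sn]]; first by case=> // _ [n _ <-]; exists n.
by rewrite (lt_le_trans sn)//; apply: sup_upper_bound; [split => //; exists 1|exists n].
Qed.

Lemma assemble_digits01 b (x : R) : (forall n q, (b n q < 2 ^ n)%N) ->
  0 <= assemble_digits b x <= 1.
Proof.
move=> lb; have ub : ubound (range (approx_digits 4 b ^~ x)) 1.
  move=> _ [n _ <-]; rewrite /approx_digits ler_pdivrMr ?ltr0n ?expn_gt0// mul1r.
  by rewrite ler_nat ltnW.
apply/andP; split.
  apply: (@le_trans _ _ (approx_digits 4 b 0 x)); first by rewrite /approx_digits divr_ge0.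
  by apply: sup_upper_bound; [split; [exists (approx_digits 4 b 0 x), 0%N|exists 1]|exists 0%N].
by apply: ge_sup => //; exists (approx_digits 4 b 0 x), 0%N.
Qed.

Lemma measurable_approx_gt (B : nat) b n s : (0 < B)%N ->
  measurable [set x : R | s < approx_digits B b n x].
Proof.
move=> B0; apply: (@measurable_cells R (B ^ n)
  (fun q => s < (b n q)%:R / (2 ^ n)%N%:R)).
by rewrite expn_gt0 B0.
Qed.

Lemma measurable_assemble b : (forall n q, (b n q < 2 ^ n)%N) ->
  measurable_fun setT (assemble_digits b).
Proof.
move=> lb; apply: (measurability _ (measurable_realfun.RGenOInfty.measurableE R)).
move=> _ [_ [s ->] <-]; rewrite setTI.
rewrite (_ : _ @^-1` _ = \bigcup_n [set x : R | s < approx_digits 4 b n x]).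
  by apply: bigcupT_measurable => n; exact: measurable_approx_gt.
apply/seteqP; split => x /=; rewrite in_itv /= andbT.
  by move/(assemble_gt _ _ lb) => [n sn]; exists n.
by move=> [n _ sn]; apply/(assemble_gt _ _ lb); exists n.
Qed.

(** With B = 2, the digits of x itself. *)
Let whole : digit_fun := fun n q => q.

(** The same finite counts as for the two halves, computed for x itself, converge
    to its law: this identifies the limits in [unif01_high_low] without
    evaluating them. *)
Lemma unif01_gt s :
  (fun n => ((\sum_(j < 2 ^ n) (s < j%:R / (2 ^ n)%N%:R)%R)%N%:R / (2 ^ n)%N%:R)%:E)
    @ \oo --> unif01 `]s, +oo[.
Proof.
pose F n := [set x : R | s < approx_digits 2 whole n x] `&` `[0, 1].
have mF n : measurable (F n) by apply: measurableI => //; exact: measurable_approx_gt.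
have eF : `]s, +oo[ `&` `[0, 1] = \bigcup_n F n.
  apply/seteqP; split => x /=.
    rewrite !in_itv /= andbT => -[sx /andP[x0 x1]].
    have [n nP] : exists n, (x - s)^-1 < (2 ^ n)%N%:R.
      exists (Num.truncn (x - s)^-1).+1; rewrite (lt_trans (truncnS_gt _))// ltr_nat.
      by rewrite ltn_expl.
    exists n => //; split; last by rewrite /= in_itv /= x0 x1.
    rewrite /= /approx_digits /whole ltr_pdivlMr ?ltr0n ?expn_gt0//.
    have := truncnS_gt ((2 ^ n)%N%:R * x); rewrite -natr1.
    have : 1 < (x - s) * (2 ^ n)%N%:R.
      by rewrite -ltr_pdivrMl ?subr_gt0// mulr1.
    lra.
  move=> [n _] [/= + x01]; rewrite in_itv /= andbT => sn; split => //.
  move: x01; rewrite in_itv /= => /andP[x0 _]; rewrite (lt_le_trans sn)//.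
  rewrite /approx_digits ler_pdivrMr ?ltr0n ?expn_gt0// mulrC.
  by rewrite truncn_le mulr_ge0.
rewrite /unif01 /mrestr eF.
rewrite [X in X @ _](_ : _ = lebesgue_measure \o F); last first.
  apply/funext => n /=; rewrite /F /approx_digits.
  by rewrite (@lebesgue_cells R (2 ^ n) (fun q => s < q%:R / (2 ^ n)%N%:R)) ?expn_gt0.
apply: nondecreasing_cvg_mu => //; first exact: bigcupT_measurable.
move=> n m nm; apply/subsetPset => x [/= sx x01]; split => //=.
rewrite (lt_le_trans sx)//; apply: approx_digits_nondecreasing => //.
by move=> k q; rewrite /whole; lia.
Qed.

(** At each finite level the joint count factors by [sum_deinterleave]. *)
Lemma unif01_high_low s t :
  unif01 (assemble_digits high_bits @^-1` `]s, +oo[ `&`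
          assemble_digits low_bits @^-1` `]t, +oo[) =
  (unif01 `]s, +oo[ * unif01 `]t, +oo[)%E.
Proof.
pose F n := [set x : R | (s < approx_digits 4 high_bits n x) &&
                         (t < approx_digits 4 low_bits n x)] `&` `[0, 1].
pose N (u : R) n := ((\sum_(j < 2 ^ n) (u < j%:R / (2 ^ n)%N%:R)%R)%N%:R / (2 ^ n)%N%:R : R)%:E.
have ndF n m : (n <= m)%N -> F n `<=` F m.
  move=> nm x [/= /andP[sx tx] x01]; split => //=; apply/andP; split.
    by rewrite (lt_le_trans sx)//; apply: approx_digits_nondecreasing coherent_high _ _ nm.
  by rewrite (lt_le_trans tx)//; apply: approx_digits_nondecreasing coherent_low _ _ nm.
have mF n : measurable (F n).
  apply: measurableI => //; apply: (@measurable_cells R (4 ^ n)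
   (fun q => (s < (high_bits n q)%:R / (2 ^ n)%N%:R) && (t < (low_bits n q)%:R / (2 ^ n)%N%:R))).
  by rewrite expn_gt0.
have eF : lebesgue_measure \o F = (fun n => N s n * N t n)%E.
  apply/funext => n /=; rewrite /F /approx_digits.
  rewrite (@lebesgue_cells R (4 ^ n) (fun q => (s < (high_bits n q)%:R / (2 ^ n)%N%:R) &&
     (t < (low_bits n q)%:R / (2 ^ n)%N%:R))) ?expn_gt0//.
  rewrite /N -EFinM; congr EFin; rewrite mulf_div -!natrM.
  rewrite -(sum_deinterleave n (fun j => (s < j%:R / (2 ^ n)%N%:R)%R : nat)
    (fun k => (t < k%:R / (2 ^ n)%N%:R)%R : nat)) -expnMn.
  by congr (_%:R / _); apply: eq_bigr => q _; rewrite mulnb.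
have cvgF : lebesgue_measure \o F @ \oo --> lebesgue_measure (\bigcup_n F n).
  apply: nondecreasing_cvg_mu => //; first exact: bigcupT_measurable.
  by move=> n m nm; apply/subsetPset; exact: ndF.
rewrite eF in cvgF.
have cvgN : (fun n => N s n * N t n)%E @ \oo --> (unif01 `]s, +oo[ * unif01 `]t, +oo[)%E.
  apply: cvgeM; [|exact: unif01_gt|exact: unif01_gt].
  by rewrite mule_def_fin// fin_num_measure.
rewrite -(cvg_unique _ cvgF cvgN) //.
congr (lebesgue_measure _); apply/seteqP; split => x /=.
  rewrite !in_itv /= !andbT => -[[]].
  move=> /(assemble_gt _ _ high_bits_lt)[n sn] /(assemble_gt _ _ low_bits_lt)[m tm] x01.
  exists (maxn n m) => //; split; last by rewrite /= in_itv.
  apply/andP; split.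
    rewrite (lt_le_trans sn)//; apply: approx_digits_nondecreasing coherent_high _ _ _ => //.
    exact: leq_maxl.
  rewrite (lt_le_trans tm)//; apply: approx_digits_nondecreasing coherent_low _ _ _ => //.
  exact: leq_maxr.
move=> [n _ [/= /andP[sn tn] x01]]; rewrite !in_itv /= !andbT; split => //; split.
  by apply/(assemble_gt _ _ high_bits_lt); exists n.
by apply/(assemble_gt _ _ low_bits_lt); exists n.
Qed.

Lemma unif01_split (A B : set R) : measurable A -> measurable B ->
  unif01 (assemble_digits high_bits @^-1` A `&` assemble_digits low_bits @^-1` B) =
  (unif01 A * unif01 B)%E.
Proof.
pose G := [set A : set R | A = setT \/ exists s, A = `]s, +oo[%classic].
have GI : setI_closed G.
  move=> C D [->|[s ->]] [->|[t ->]]; rewrite ?setTI ?setIT; [by left|by right; exists t..| |].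
    by right; exists s.
  right; exists (Num.max s t); apply/seteqP; split => x /=; rewrite !in_itv /= !andbT gt_max.
    by move=> [-> ->].
  by move=> /andP.
have mG : @measurable _ R = <<s G >>.
  rewrite (_ : @measurable _ R = <<s @measurable_realfun.RGenOInfty.G R >>); last first.
    exact: measurable_realfun.RGenOInfty.measurableE.
  apply/seteqP; split; apply: smallest_sub.
  - exact: smallest_sigma_algebra.
  - by move=> C [s ->]; apply: sub_sigma_algebra; right; exists s.
  - exact: smallest_sigma_algebra.
  - move=> C [->|[s ->]]; last by apply: sub_sigma_algebra; exists s.
    exact: (@measurableT _ (g_sigma_algebraType (@measurable_realfun.RGenOInfty.G R))).
(* All values are nonnegative, so the whole line can be replaced by ]-1, +oo[. *)
have whole01 b C : (forall n q, (b n q < 2 ^ n)%N) -> G C -> exists s,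
    assemble_digits b @^-1` C = assemble_digits b @^-1` `]s, +oo[ /\
    unif01 C = unif01 `]s, +oo[.
  move=> lb [->|[s ->]]; last by exists s.
  exists (-1); split.
    apply/seteqP; split => x //= _; rewrite in_itv /= andbT.
    by have /andP[x0 _] := assemble_digits01 x lb; rewrite (lt_le_trans _ x0)// ltrN10.
  rewrite /unif01 /mrestr; congr (lebesgue_measure _); apply/seteqP; split => x /=.
    by rewrite !in_itv /= andbT => -[_ /andP[x0 x1]]; rewrite (lt_le_trans _ x0)// ?ltrN10// x0.
  by move=> [].
have GT : G setT by left.
have mh : measurable_fun setT (assemble_digits high_bits).
  exact: measurable_assemble high_bits_lt.
have ml : measurable_fun setT (assemble_digits low_bits).
  exact: measurable_assemble low_bits_lt.
apply: (@independent_of_pi_system _ _ _ _ _ _ _ unif01 unif01 unif01 _ _ G G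
  mh ml mG GI GT mG GI GT).
move=> C D /(whole01 _ _ high_bits_lt)[s [eC uC]] /(whole01 _ _ low_bits_lt)[t [eD uD]].
by have := unif01_high_low s t; rewrite -uC -uD -eC -eD.
Qed.
End UniformSplitting.

(** * The product measure on the cube *)

Section Cube.
Variables (R : realType) (Gam : markedGroup).
Local Open Scope ereal_scope.
Implicit Types (J : {fset Gam}) (B : Gam -> set R) (x y : cube R Gam).

Definition box J B : set (cube R Gam) :=
  [set x | forall v, v \in J -> B v ((x v)%:num)%R].

Definition boxes : set (set (cube R Gam)) :=
  [set C | exists J B, (forall v, measurable (B v)) /\ C = box J B].

Lemma measurable_coord v :
  measurable_fun setT (fun x : cube R Gam => ((x v)%:num)%R : R).
Proof.
move=> _ B mB; rewrite setTI; apply: sub_sigma_algebra.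
by exists v, B.
Qed.

Lemma measurable_box J B : (forall v, measurable (B v)) -> measurable (box J B).
Proof.
move=> mB; rewrite (_ : box J B =
    \bigcap_(v in [set` J]) ((fun x : cube R Gam => ((x v)%:num)%R : R) @^-1` B v)).
  apply: fin_bigcap_measurable => [|v _]; first exact: finite_fset.
  by rewrite -[_ @^-1` _]setTI; exact: measurable_coord.
by apply/seteqP; split => x /= h v; exact: h.
Qed.

(** Lets two boxes be compared on a common set of coordinates. *)
Definition extend_box J B v : set R := if v \in J then B v else setT.

Lemma measurable_extend_box J B : (forall v, measurable (B v)) ->
  forall v, measurable (extend_box J B v).
Proof. by move=> mB v; rewrite /extend_box; case: ifP. Qed.

Lemma box_extend J K B : {subset J <= K} -> box J B = box K (extend_box J B).
Proof.
move=> JK; apply/seteqP; split => x /= h v vJ; rewrite /extend_box.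
  by case: ifPn => // vJ'; exact: h.
by have := h v (JK _ vJ); rewrite /extend_box vJ.
Qed.

Lemma boxI J J' B B' : box J B `&` box J' B' =
  box (J `|` J')%fset (fun v => extend_box J B v `&` extend_box J' B' v).
Proof.
rewrite (@box_extend J (J `|` J')%fset); last by move=> v; rewrite in_fsetU => ->.
rewrite (@box_extend J' (J `|` J')%fset); last by move=> v; rewrite in_fsetU orbC => ->.
by apply/seteqP; split => x /= => [[h h'] v vJ|h];
  [split; [exact: h|exact: h']|split=> v vJ; have [] := h v vJ].
Qed.

Lemma boxes_setI : setI_closed boxes.
Proof.
move=> _ _ [J [B [mB ->]]] [J' [B' [mB' ->]]]; rewrite boxI.
do 2!eexists; split; last reflexivity.
by move=> v; apply: measurableI; exact: measurable_extend_box.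
Qed.

Lemma boxes_setT : boxes setT.
Proof.
exists fset0, (fun=> setT); split=> //.
by apply/seteqP; split => x //= _ v; rewrite in_fset0.
Qed.

Lemma measurable_cubeE : @measurable _ (cube R Gam) = <<s boxes >>.
Proof.
apply/seteqP; split; apply: smallest_sub; try exact: smallest_sigma_algebra.
  move=> _ [v [B [mB ->]]]; apply: sub_sigma_algebra; exists [fset v]%fset, (fun=> B).
  split=> //; apply/seteqP; split => x /= h; first by move=> u; rewrite inE => /eqP->.
  by apply: h; rewrite inE.
by move=> _ [J [B [mB ->]]]; exact: measurable_box.
Qed.

Lemma measurable_to_cube d (T : measurableType d) (f : T -> cube R Gam) :
  (forall v, measurable_fun setT (fun t => ((f t v)%:num)%R : R)) ->
  measurable_fun setT f.
Proof.
move=> mf; apply: (@measurability _ _ _ (cube R Gam) setT f (coord_sets R Gam)) => //.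
by move=> _ [_ [v [B [mB ->]]] <-]; exact: mf.
Qed.

Definition digits_part (b : nat -> nat -> nat) (lb : forall n q, (b n q < 2 ^ n)%N)
    (x : cube R Gam) : cube R Gam :=
  fun v => Itv01 (proj1 (andP (assemble_digits01 ((x v)%:num)%R lb)))
                 (proj2 (andP (assemble_digits01 ((x v)%:num)%R lb))).

Definition cube_comp (f : Gam -> Gam) (y : cube R Gam) : cube R Gam := fun v => y (f v).

(** The two halves are computed coordinate by coordinate, hence commute with
    every permutation of the coordinates by conversion. *)
Definition left_half := digits_part high_bits_lt.
Definition right_half := digits_part low_bits_lt.

Lemma measurable_digits_part b (lb : forall n q, (b n q < 2 ^ n)%N) :
  measurable_fun setT (digits_part lb).
Proof.
apply: measurable_to_cube => v.
exact: (measurableT_comp (measurable_assemble lb) (measurable_coord v)).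
Qed.

Lemma measurable_pre d (T : measurableType d) d' (T' : measurableType d')
  (f : T -> T') C : measurable_fun setT f -> measurable C -> measurable (f @^-1` C).
Proof. by move=> mf mC; rewrite -[_ @^-1` _]setTI; exact: mf. Qed.

Section ProductMeasure.
Variable lam : probability (cube R Gam) R.
Hypothesis lamP : is_product_lebesgue lam.

Lemma box_measure J B : (forall v, measurable (B v)) ->
  lam (box J B) = \prod_(v <- J) unif01 (B v).
Proof. exact: lamP. Qed.

(** On boxes this is [unif01_split] in each coordinate. *)
Lemma halves_independent (C D : set (cube R Gam)) : measurable C -> measurable D ->
  lam (left_half @^-1` C `&` right_half @^-1` D) = lam C * lam D.
Proof.
move: C D; apply: (@independent_of_pi_system _ _ _ _ _ _ _ lam lam lam _ _ boxes boxes
  (measurable_digits_part _) (measurable_digits_part _) measurable_cubeE boxes_setI boxes_setT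
  measurable_cubeE boxes_setI boxes_setT).
move=> _ _ [J [B [mB ->]]] [J' [B' [mB' ->]]].
rewrite (@box_extend J (J `|` J')%fset); last by move=> v; rewrite in_fsetU => ->.
rewrite (@box_extend J' (J `|` J')%fset); last by move=> v; rewrite in_fsetU orbC => ->.
have mE := measurable_extend_box J mB; have mE' := measurable_extend_box J' mB'.
suff key : lam (left_half @^-1` box (J `|` J')%fset (extend_box J B) `&`
    right_half @^-1` box (J `|` J')%fset (extend_box J' B')) =
    lam (box (J `|` J')%fset (extend_box J B)) *
    lam (box (J `|` J')%fset (extend_box J' B')) by exact: key.
rewrite !box_measure// -big_split /=.
under eq_bigr do rewrite -unif01_split//.
rewrite -box_measure; last first.
  move=> v; apply: measurableI; apply: measurable_pre => //; apply: measurable_assemble.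
    exact: high_bits_lt.
  exact: low_bits_lt.
congr (lam _); apply/seteqP; split => x /=.
  by move=> [h h'] v vJ; split; [exact: h|exact: h'].
by move=> h; split => v vJ; have [] := h v vJ.
Qed.

Lemma left_half_law C : measurable C -> lam (left_half @^-1` C) = lam C.
Proof.
move=> mC; have := halves_independent mC measurableT.
by rewrite setIT probability_setT mule1.
Qed.

(** Only the number of coordinates that a box constrains, and how, matters for
    its measure, so that renaming the coordinates does not change it. *)
Lemma law_cube_comp (f g : Gam -> Gam) C : cancel f g -> cancel g f -> measurable C ->
  lam (cube_comp f @^-1` C) = lam C.
Proof.
move=> fK gK; have mh : measurable_fun setT (@cube_comp f).
  by apply: measurable_to_cube => v; exact: measurable_coord.
move: C; apply: (@finite_measure_unique _ _ _ boxes (pushforward lam (cube_comp f)) lam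
  measurable_cubeE boxes_setI).
- by rewrite /= /pushforward preimage_setT (le_lt_trans (probability_le1 _ _))// ltry.
- by rewrite /= /pushforward preimage_setT.
- move=> _ [J [B [mB ->]]]; rewrite /= /pushforward.
  rewrite (_ : cube_comp f @^-1` box J B = box (f @` J)%fset (fun v => B (g v))).
    rewrite !box_measure// big_imfset /=; last by move=> u v _ _; exact: (can_inj fK).
    by apply: eq_bigr => v _; rewrite fK.
  apply/seteqP; split => x /= H v.
    by move=> /imfsetP[u /= uJ ->]; rewrite fK; exact: H.
  by move=> vJ; have := H (f v); rewrite fK; apply; apply/imfsetP; exists v.
Qed.
End ProductMeasure.
End Cube.

Section RandomReindexing.
Variables (R : realType) (Gam : markedGroup).
Local Open Scope ring_scope.
Local Open Scope ereal_scope.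

Lemma countable_markedGroup : countable [set: Gam].
Proof.
pose ev (s : seq (gens Gam)) : Gam := (\prod_(h <- s) val h)%g.
rewrite (_ : [set: Gam] = ev @` setT).
  exact: (sub_countable (card_image_le _ _) (countableP _)).
apply/seteqP; split => // g _; have [s [sE ->]] := gens_gen g.
exists (pmap insub s) => //; rewrite /ev -(big_map val xpredT id) /=.
rewrite (pmap_filter (insubK _)) (_ : [seq x <- s | _] = s)//.
by apply/all_filterP/allP => h /sE hE; rewrite insubT.
Qed.

Section Measurable.
Variables (d : measure_display) (T : measurableType d).

Lemma measurable_const_event (Q : Prop) : measurable [set _ : T | Q].
Proof.
have [q|q] := pselect Q.
  by rewrite (_ : mkset _ = setT)//; apply/seteqP; split.
by rewrite (_ : mkset _ = set0)//; apply/seteqP; split.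
Qed.

Lemma measurable_level_sets (U : Type) (f : T -> U) : countable [set: U] ->
  (forall u, measurable [set t | f t = u]) -> forall P : set U, measurable [set t | P (f t)].
Proof.
move=> cU mf P; rewrite (_ : mkset _ = \bigcup_u ([set t | f t = u] `&` [set _ | P u])).
  apply: countable_bigcupT_measurable => // u; apply: measurableI => //.
  exact: measurable_const_event.
by apply/seteqP; split => t /= => [Pt|[u _ [<-]]//]; exists (f t).
Qed.

(** Countably many values let a random index be conditioned on. *)
Lemma measurable_random_index (U : Type) (f : T -> U) (P : U -> set T) :
  countable [set: U] -> (forall u, measurable [set t | f t = u]) ->
  (forall u, measurable (P u)) -> measurable [set t | P (f t) t].
Proof.
move=> cU mf mP; rewrite (_ : mkset _ = \bigcup_u ([set t | f t = u] `&` P u)).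
  by apply: countable_bigcupT_measurable => // u; exact: measurableI.
by apply/seteqP; split => t /= => [Pt|[u _ [<-]]//]; exists (f t).
Qed.

Lemma measurable_mismatch (U : Type) (f g : T -> U) : countable [set: U] ->
  (forall u, measurable [set t | f t = u]) -> (forall u, measurable [set t | g t = u]) ->
  measurable [set t | g t <> f t].
Proof.
move=> cU mf mg; apply: (measurable_random_index (P := fun u => [set t | g t <> u]) cU mf).
by move=> u; exact: (measurableC (mg u)).
Qed.

Lemma measurable_random_cube_comp (psi : T -> Gam -> Gam) (y : T -> cube R Gam) :
  (forall v w, measurable [set t | psi t v = w]) -> measurable_fun setT y ->
  measurable_fun setT (fun t => cube_comp (psi t) (y t)).
Proof.
move=> mpsi my; apply: measurable_to_cube => v _ B mB; rewrite setTI.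
apply: (@measurable_random_index _ (psi^~ v)
  (fun w => (fun t => ((y t w)%:num)%R : R) @^-1` B) countable_markedGroup) => // w.
by rewrite -[_ @^-1` _]setTI; apply: (measurableT_comp (measurable_coord _) my).
Qed.
End Measurable.

Variable lam : probability (cube R Gam) R.
Hypothesis lamP : is_product_lebesgue lam.

(** The bijection is a function of one half of the randomness and is applied to
    the other half: it is fixed once the first half is, so that Fubini reduces
    this to [law_cube_comp]. *)
Lemma law_random_cube_comp (Phi : cube R Gam -> Gam -> Gam) (C : set (cube R Gam)) :
  (forall z, bijective (Phi z)) -> (forall v w, measurable [set z | Phi z v = w]) ->
  measurable C ->
  lam [set x | C (cube_comp (Phi (left_half x)) (right_half x))] = lam C.
Proof.
move=> bPhi mPhi mC.
pose pair x : cube R Gam * cube R Gam := (left_half x, right_half x).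
have mpair : measurable_fun setT pair.
  by apply: measurable_fun_pair; exact: measurable_digits_part.
pose W := [set p : cube R Gam * cube R Gam | C (cube_comp (Phi p.1) p.2)].
have mW : measurable W.
  apply: measurable_pre mC; apply: measurable_random_cube_comp; last exact: measurable_snd.
  by move=> v w; apply: (measurable_pre (f := fst) (C := [set z | Phi z v = w])).
have E := @product_measure_unique _ _ _ _ _ lam lam (pushforward lam pair)
  (@halves_independent _ _ _ lamP) W mW.
apply: etrans (esym (E mpair)) _.
rewrite /product_measure1 (eq_integral (cst (lam C))) => [|z _].
  apply: (@etrans _ _ (lam C * lam setT)); first by rewrite integral_cst.
  by rewrite probability_setT mule1.
have [g fK gK] := bPhi z.
rewrite /= -(law_cube_comp lamP fK gK mC); congr (lam _).
by apply/seteqP; split => y; rewrite /xsection /= inE.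
Qed.
End RandomReindexing.

(** * Balls and their isomorphisms *)

Section Balls.
Context {Gam : markedGroup}.
Local Open Scope group_scope.
Implicit Types x y u v g : Gam.

Lemma adjC x y : adj x y = adj y x.
Proof. by apply/idP/idP; exact: adj_sym. Qed.

Lemma adj_mul g x : adj x (g * x) = (g \in gens Gam).
Proof. by rewrite /adj mulgK. Qed.

Lemma cball1 r : @cball Gam r 1.
Proof. by exists [::]. Qed.

Lemma cball_step r x y : cball r x -> adj x y -> cball r.+1 y.
Proof.
move=> [p [pp <- sp]] xy; exists (rcons p y).
by rewrite rcons_path pp xy last_rcons size_rcons.
Qed.

Lemma cball_mono r m x : (m <= r)%N -> cball m x -> cball r x.
Proof. by move=> mr [p [pp px sp]]; exists p; split => //; exact: leq_trans sp mr. Qed.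

Lemma cball0 x : cball 0 x -> x = 1.
Proof. by move=> [[|? ?] [_ <-]]. Qed.

Lemma cballS r x : cball r.+1 x -> cball r x \/ exists2 y, cball r y & adj y x.
Proof.
move=> [p]; case/lastP: p => [|p y] [].
  by move=> _ <- _; left; exact: cball1.
rewrite rcons_path last_rcons size_rcons => /andP[pp yx] <- sp.
by right; exists (last 1 p) => //; exists p.
Qed.

Lemma cball_prod m u (s : seq Gam) : {subset s <= gens Gam} -> cball m u ->
  cball (m + size s) (\prod_(h <- s) h * u).
Proof.
move=> + mu; elim: s => [|g s IH] sE; first by rewrite big_nil mul1g addn0.
rewrite big_cons /= addnS -mulgA; apply: cball_step (IH _) _.
  by move=> h hs; apply: sE; rewrite inE hs orbT.
by rewrite adj_mul sE// mem_head.
Qed.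

Lemma word_of_path x p : path adj x p -> exists s : seq Gam,
  [/\ {subset s <= gens Gam}, size s = size p & last x p = \prod_(h <- s) h * x].
Proof.
elim: p x => [|y p IH] x /=; first by exists [::]; rewrite big_nil mul1g.
move=> /andP[xy /IH[s [sE ss ->]]]; exists (rcons s (y * x^-1)); split.
- by move=> h; rewrite mem_rcons inE => /orP[/eqP->//|]; exact: sE.
- by rewrite size_rcons ss.
- by rewrite -cats1 big_cat big_seq1 /= -mulgA mulgVK.
Qed.

Lemma cball_connected x : exists r, cball r x.
Proof.
have [s [sE ->]] := gens_gen x; exists (0 + size s)%N.
by rewrite -[X in cball _ X]mulg1; apply: cball_prod (cball1 _).
Qed.

Fixpoint ball_seq r : seq Gam :=
  if r is m.+1 then
    ball_seq m ++ [seq g * x | g <- enum_fset (gens Gam), x <- ball_seq m]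
  else [:: 1].

Lemma cball_seq r x : cball r x -> x \in ball_seq r.
Proof.
elim: r x => [|r IH] x; first by move/cball0->; rewrite inE.
rewrite mem_cat => /cballS[/IH->//|[y /IH yr yx]].
apply/orP; right; apply/allpairsP; exists (x * y^-1, y) => /=; split => //.
by rewrite mulgVK.
Qed.

Section Isomorphisms.
Variables (k : label_kind) (A : Type).
Implicit Types l : labelling Gam k A.

(** [ball_iso] with the isomorphism exposed. *)
Definition is_ball_iso r l l' (phi : Gam -> Gam) : Prop :=
  [/\ set_bij (cball r) (cball r) phi,
      phi 1 = 1,
      {in cball r &, forall x y, adj (phi x) (phi y) = adj x y} &
      forall s t : site Gam k, cball r (val s).1 -> cball r (val s).2 ->
        val t = (phi (val s).1, phi (val s).2) -> l' t = l s].

Lemma is_ball_iso_adj r l l' phi x y : is_ball_iso r l l' phi ->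
  cball r x -> cball r y -> adj (phi x) (phi y) = adj x y.
Proof. by move=> [_ _ + _] rx ry; apply; rewrite inE. Qed.

Lemma is_ball_iso_inj r l l' phi x y : is_ball_iso r l l' phi ->
  cball r x -> cball r y -> phi x = phi y -> x = y.
Proof. by move=> [[_ + _] _ _ _] rx ry; apply; rewrite inE. Qed.

(** Distances from the root are witnessed by paths that stay in the ball. *)
Lemma is_ball_iso_center r l l' phi m x : is_ball_iso r l l' phi -> (m <= r)%N ->
  cball m x -> cball m (phi x).
Proof.
move=> iso; have [_ phi1 _ _] := iso.
elim: m x => [|m IH] x mr; first by move=> /cball0 ->; rewrite phi1; exact: cball1.
move=> /[dup] xm /cballS[xm'|[y ym yx]].
  by apply: (@cball_mono m.+1 m) => //; apply: IH => //; exact: ltnW.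
apply: cball_step (IH _ (ltnW mr) ym) _; rewrite (is_ball_iso_adj iso)//.
  exact: cball_mono (ltnW mr) ym.
exact: cball_mono mr xm.
Qed.

Lemma is_ball_iso_id r l : is_ball_iso r l l id.
Proof.
split => // [|s t _ _]; last by rewrite -surjective_pairing => /val_inj ->.
by split => // y; exists y.
Qed.

Lemma is_ball_iso_inv r l l' phi : is_ball_iso r l l' phi ->
  exists psi, [/\ is_ball_iso r l' l psi,
    forall x, cball r x -> psi (phi x) = x & forall x, cball r x -> phi (psi x) = x].
Proof.
move=> iso; have [[fphi iphi sphi] phi1 aphi lphi] := iso.
have /choice[psi psiP] (y : Gam) : exists x, cball r y -> cball r x /\ phi x = y.
  have [ry|ry] := pselect (cball r y); last by exists 1.
  by have [x rx <-] := sphi y ry; exists x.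
have psiK x : cball r x -> phi (psi x) = x by move=> /psiP[].
have rpsi x : cball r x -> cball r (psi x) by move=> /psiP[].
have phiK x : cball r x -> psi (phi x) = x.
  move=> rx; apply: (is_ball_iso_inj iso) => //; first exact/rpsi/fphi.
  exact/psiK/fphi.
exists psi; split => //; split.
- split => [x /rpsi//|x y|y ry]; last by exists (phi y); [exact: fphi|exact: phiK].
  by rewrite !inE => /psiK + /psiK + e; rewrite e => -> ->.
- by rewrite -{1}phi1 phiK//; exact: cball1.
- move=> x y; rewrite !inE => rx ry.
  by rewrite -(is_ball_iso_adj iso) ?psiK//; exact: rpsi.
- move=> s t rs1 rs2 e; apply/esym/lphi; rewrite ?e; [exact: rpsi|exact: rpsi|].
  by rewrite /= !psiK// -surjective_pairing.
Qed.

Lemma is_ball_iso_comp r l l' l'' phi psi : is_ball_iso r l l' phi ->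
  is_ball_iso r l' l'' psi -> is_ball_iso r l l'' (psi \o phi).
Proof.
move=> iso iso'; have [[f1 i1 s1] p1 a1 l1] := iso; have [[f2 i2 s2] p2 a2 l2] := iso'.
split; first split.
- by move=> x rx; apply: f2; exact: f1.
- move=> x y /[!inE] rx ry e; apply: (is_ball_iso_inj iso) => //.
  by apply: (is_ball_iso_inj iso') => //; exact: f1.
- by move=> z /s2[y /s1[x rx <-] <-]; exists x.
- by rewrite /= p1.
- move=> x y /[!inE] rx ry.
  by rewrite /= (is_ball_iso_adj iso') ?(is_ball_iso_adj iso)//; exact: f1.
- move=> s t rs1 rs2 e.
  (* phi s is a site again because phi preserves adjacency and equality. *)
  have site_phi : is_site k (phi (val s).1, phi (val s).2).
    have adjE := is_ball_iso_adj iso rs1 rs2.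
    have eqE : (phi (val s).1 == phi (val s).2) = ((val s).1 == (val s).2).
      by apply/eqP/eqP => [|->//]; exact: (is_ball_iso_inj iso).
    move: (valP s) adjE eqE; move: (val s).
    by move=> p h adjE eqE; case: (k) h => /=; rewrite ?adjE ?eqE.
  rewrite -(l1 s (Sub _ site_phi))//; apply: l2 => //=; exact: f1.
Qed.

Lemma is_ball_iso_restrict r m l l' phi : is_ball_iso r l l' phi -> (m <= r)%N ->
  is_ball_iso m l l' phi.
Proof.
move=> iso mr; have [[f i s] p a ll] := iso.
have sub x : cball m x -> cball r x by exact: cball_mono.
split => //; first split.
- by move=> x; exact: is_ball_iso_center iso mr.
- by move=> x y /[!inE] /sub rx /sub ry; exact: is_ball_iso_inj iso rx ry.
- have [psi [iso' _ psiK]] := is_ball_iso_inv iso.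
  by move=> x mx; exists (psi x); [exact: is_ball_iso_center iso' mr mx|exact/psiK/sub].
- by move=> x y /[!inE] /sub rx /sub ry; exact: is_ball_iso_adj iso rx ry.
- by move=> s' t /sub ? /sub ?; exact: ll.
Qed.

Lemma ball_iso_sym r l l' : ball_iso r l l' -> ball_iso r l' l.
Proof. by move=> [phi /is_ball_iso_inv[psi [iso _ _]]]; exists psi. Qed.

Lemma ball_iso_trans r l l' l'' : ball_iso r l l' -> ball_iso r l' l'' -> ball_iso r l l''.
Proof. by move=> [phi h] [psi h']; exists (psi \o phi); exact: is_ball_iso_comp h h'. Qed.

Lemma ball_iso_mono r m l l' : (m <= r)%N -> ball_iso r l l' -> ball_iso m l l'.
Proof. by move=> mr [phi h]; exists phi; exact: is_ball_iso_restrict h mr. Qed.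

Lemma iso_classP r l l' : iso_class r l = iso_class r l' <-> ball_iso r l l'.
Proof.
split=> [e|h].
  have : iso_class r l' l' by exists id; exact: is_ball_iso_id.
  by rewrite -e.
apply/seteqP; split => l'' /=; apply: ball_iso_trans => //; exact: ball_iso_sym.
Qed.

Lemma cball_aut r (f : aut Gam) x : f 1 = 1 -> cball r x -> cball r (f x).
Proof.
move=> f1 [p [pp <- sp]]; exists (map f p); rewrite size_map -{1 2}f1 last_map.
split => //; rewrite path_map; apply: sub_path pp => u v /=.
by rewrite aut_adj.
Qed.

Lemma is_ball_iso_aut r l (f : aut Gam) : f 1 = 1 -> is_ball_iso r l (lab_act f l) f.
Proof.
move=> f1; have f1' : aut_inverse f 1 = 1 by rewrite -f1 /= aut_funK.
split => //; first split.
- by move=> x; exact: cball_aut.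
- by move=> x y _ _; exact: (can_inj (aut_funK f)).
- move=> y ry; exists (aut_inverse f y); last exact: aut_invK.
  exact: (cball_aut f1').
- by move=> x y _ _; exact: aut_adj.
- move=> s t _ _ e; rewrite /lab_act; congr (l _); apply: val_inj.
  by rewrite /= e /= !aut_funK -surjective_pairing.
Qed.
End Isomorphisms.
End Balls.

(** * Walking along the labels of a diagram *)

Section Development.
Context {Gam : markedGroup}.
Local Open Scope group_scope.
Implicit Types (x y u v g : Gam) (c : labelling Gam Edges (gens Gam)) (s : seq Gam).

Lemma edge_labelE c (e : site Gam Edges) :
  edge_label c (val e).1 (val e).2 = val (c e).
Proof.
rewrite /edge_label; case: insubP => [e' _ ee'|].
  by congr (val (c _)); apply: val_inj; rewrite ee' -surjective_pairing.
by rewrite -surjective_pairing (valP e).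
Qed.

Lemma edge_label_gens c x y : adj x y -> edge_label c x y \in gens Gam.
Proof.
move=> xy; pose e : site Gam Edges := Sub (x, y) (xy : is_site Edges (x, y)).
by rewrite -[x]/(val e).1 -[y]/(val e).2 edge_labelE; exact: valP.
Qed.

Lemma edge_label_st x y : adj x y -> edge_label c_st x y = x * y^-1.
Proof.
move=> xy; pose e : site Gam Edges := Sub (x, y) (xy : is_site Edges (x, y)).
by rewrite -[x]/(val e).1 -[y]/(val e).2 edge_labelE.
Qed.

Lemma edge_label_act c (f : aut Gam) x y :
  edge_label (lab_act f c) (f x) (f y) = edge_label c x y.
Proof.
rewrite /edge_label; case: (boolP (adj x y)) => xy; last first.
  by rewrite !insubF //=; [exact: negbTE|rewrite aut_adj; exact: negbTE].
rewrite (insubT (is_site Edges) (xy : is_site Edges (x, y))).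
rewrite (insubT (is_site Edges) (_ : is_site Edges (f x, f y))) /=; first by rewrite aut_adj.
move=> h; congr (val (c _)); apply: val_inj; by rewrite /= !aut_funK.
Qed.

Lemma edge_label_ball_iso r c c' phi x y : is_ball_iso r c c' phi ->
  cball r x -> cball r y -> adj x y -> edge_label c' (phi x) (phi y) = edge_label c x y.
Proof.
move=> iso rx ry xy.
have xy' : adj (phi x) (phi y) by rewrite (is_ball_iso_adj iso).
pose e : site Gam Edges := Sub (x, y) (xy : is_site Edges (x, y)).
pose e' : site Gam Edges := Sub (phi x, phi y) (xy' : is_site Edges (phi x, phi y)).
rewrite -[phi x]/(val e').1 -[phi y]/(val e').2 edge_labelE.
rewrite -[x]/(val e).1 -[y]/(val e).2 edge_labelE.
by have [_ _ _ /(_ e e' rx ry erefl) ->] := iso.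
Qed.

Definition step_spec c x g y :=
  [/\ adj x y, edge_label c y x = g &
      forall z, adj x z -> edge_label c z x = g -> z = y].

(** The neighbour of x whose edge to x has label g.  Where no such neighbour
    exists, or several do, the walker stays put: this keeps the definition total
    without breaking its equivariance. *)
Definition step c x g : Gam := xget x (step_spec c x g).

(** The last generator of s is applied first, so that the walk from x ends at
    the product of s times x in the standard diagram. *)
Definition walk c x s : Gam := foldr (fun g y => step c y g) x s.

Lemma step_eq c x g y : step_spec c x g y -> step c x g = y.
Proof.
move=> Sy; rewrite /step; case: xgetP => [z _ [xz zg _]|/(_ y)//].
by have [_ _] := Sy; apply.
Qed.

Lemma step_level c x g w : (step c x g = w) <->
  step_spec c x g w \/ (w = x /\ forall z, ~ step_spec c x g z).
Proof.
split=> [<-|[/step_eq//|[-> no]]]; rewrite /step; case: xgetP => //.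
- by move=> z _; left.
- by right.
- by move=> z _ /no.
Qed.

Lemma step_act c (f : aut Gam) x g : step (lab_act f c) (f x) g = f (step c x g).
Proof.
have sp y : step_spec (lab_act f c) (f x) g (f y) <-> step_spec c x g y.
  split=> -[xy yg un]; split; rewrite ?aut_adj ?edge_label_act// in xy yg * => z.
    move=> xz zg; apply: (can_inj (aut_funK f)); apply: un; rewrite ?aut_adj//.
    by rewrite edge_label_act.
  by rewrite -(aut_invK f z) aut_adj edge_label_act => xz zg; congr (f _); exact: un.
apply/step_level; have /step_level[Sy|[-> no]] : step c x g = step c x g by [].
  by left; apply/sp.
by right; split => // z; rewrite -(aut_invK f z) => /sp; exact: no.
Qed.

Lemma walk_act c (f : aut Gam) x s : walk (lab_act f c) (f x) s = f (walk c x s).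
Proof. by elim: s => //= g s ->; rewrite step_act. Qed.

Lemma geodesic_exists g : exists s, [/\ {subset s <= gens Gam}, g = \prod_(h <- s) h &
  forall r, cball r g -> (size s <= r)%N].
Proof.
have ex : exists n, `[< exists s, [/\ {subset s <= gens Gam}, g = \prod_(h <- s) h & size s = n] >].
  by have [s [sE gs]] := gens_gen g; exists (size s); apply/asboolP; exists s.
case: (ex_minnP ex) => n /asboolP[s [sE gs sn]] nmin; exists s; split => // r [p [pp pg pr]].
have [s' [sE' ss' ps']] := word_of_path pp.
rewrite sn (leq_trans _ pr)// nmin//; apply/asboolP; exists s'; split => //.
by rewrite -pg ps' mulg1.
Qed.

(** Shortest words are used so that elements of a ball are reached without
    leaving the ball. *)
Definition geodesic g : seq Gam := sval (cid (geodesic_exists g)).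

Lemma geodesic_gens g : {subset geodesic g <= gens Gam}.
Proof. by have [] := svalP (cid (geodesic_exists g)). Qed.

Lemma geodesicE g : \prod_(h <- geodesic g) h = g.
Proof. by have [] := svalP (cid (geodesic_exists g)). Qed.

Lemma size_geodesic r g : cball r g -> (size (geodesic g) <= r)%N.
Proof. by have [_ _] := svalP (cid (geodesic_exists g)); apply. Qed.

(** The developing map from x: reads g off the labels of c, so that for a
    Cayley diagram c it is the labelled isomorphism that sends 1 to x. *)
Definition develop c x g : Gam := walk c x (geodesic g).

Lemma develop_act c (f : aut Gam) x g :
  develop (lab_act f c) (f x) g = f (develop c x g).
Proof. exact: walk_act. Qed.

(** A ball isomorphism commutes with walking as long as the walk stays in the
    ball; strictly inside, the neighbours of phi v are all images of neighbours
    of v, and so only one of them carries a given label. *)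
Lemma walk_ball_iso r c phi m u s : is_ball_iso r c_st c phi -> cball m u ->
  {subset s <= gens Gam} -> (m + size s <= r)%N ->
  walk c (phi u) s = phi (\prod_(h <- s) h * u).
Proof.
move=> iso mu; elim: s => [|g s IH] sE sr; first by rewrite big_nil mul1g.
have sE' : {subset s <= gens Gam} by move=> h hs; apply: sE; rewrite inE hs orbT.
have gE : g \in gens Gam by apply: sE; rewrite mem_head.
rewrite /= addnS in sr; rewrite /= IH//; last exact: ltnW.
set v := \prod_(h <- s) h * u; have vr := cball_prod sE' mu; rewrite -/v in vr.
have vr' : cball r v by exact: cball_mono (ltnW sr) vr.
have gvr : cball r (g * v) by apply: cball_mono sr _; apply: cball_step vr _; rewrite adj_mul.
rewrite big_cons -mulgA -/v; apply: step_eq; split.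
- by rewrite (is_ball_iso_adj iso)// adj_mul.
- rewrite (edge_label_ball_iso iso)//; last by rewrite adjC adj_mul.
  by rewrite edge_label_st ?mulgK// adjC adj_mul.
- move=> z vz zg.
  have zr : cball r z.
    apply: (cball_mono sr); apply: cball_step vz.
    by exact: is_ball_iso_center iso (ltnW sr) vr.
  have [[_ _ /(_ z zr)[w rw wz]] _ _ _] := iso; rewrite -wz in vz zg *.
  have vw : adj v w by rewrite -(is_ball_iso_adj iso).
  rewrite (edge_label_ball_iso iso)// 1?adjC// edge_label_st 1?adjC// in zg.
  by rewrite -zg mulgVK.
Qed.

Lemma develop_ball_iso r c phi m n u g : is_ball_iso r c_st c phi -> cball m u ->
  cball n g -> (m + n <= r)%N -> develop c (phi u) g = phi (g * u).
Proof.
move=> iso mu ng mn; rewrite /develop (walk_ball_iso iso mu) ?geodesicE//.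
  exact: geodesic_gens.
by apply: leq_trans mn; rewrite leq_add2l size_geodesic.
Qed.
End Development.

(** * Cayley diagrams are automorphic images of the standard one *)

Section CayleyDiagrams.
Context {Gam : markedGroup}.
Local Open Scope group_scope.
Implicit Types (x y u v g : Gam) (c : labelling Gam Edges (gens Gam)) (p q : seq Gam).

Lemma word_cat c x p q : word c x (p ++ q) = word c (last x p) q * word c x p.
Proof. by elim: p x => [|y p IH] x /=; [rewrite mulg1|rewrite IH mulgA]. Qed.

Lemma path_between x y : exists p, path adj x p /\ last x p = y.
Proof.
have [s [sE ys]] := gens_gen (y * x^-1).
have -> : y = \prod_(h <- s) h * x by rewrite -ys mulgVK.
elim: s sE {y ys} => [|g s IH] sE; first by exists [::]; rewrite big_nil mul1g.
have [p [pp lp]] := IH (fun h hs => sE h (@mem_behead _ (g :: s) h hs)).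
exists (rcons p (g * last x p)); rewrite rcons_path last_rcons pp lp big_cons -mulgA.
by rewrite adj_mul sE// mem_head.
Qed.

Section Holonomy.
Variable c : labelling Gam Edges (gens Gam).
Hypothesis cP : cayley_diagram c.

Let label_inv x y : adj x y -> edge_label c x y = (edge_label c y x)^-1.
Proof.
move=> xy; have [_ /(_ x [:: y; x])] := cP; rewrite /= xy adjC xy /= => /(_ isT)[_ /(_ erefl)].
rewrite mul1g => e; apply: (mulIg (edge_label c y x)).
by rewrite e mulVg.
Qed.

(** Follow one path backwards and then the other: the closed-path axiom applies
    to the result. *)
Lemma word_endpoint x p q : path adj x p -> path adj x q ->
  word c x p = word c x q <-> last x p = last x q.
Proof.
move=> pp pq; have [b [pb lb]] := path_between (last x p) x.
have closed : word c x (p ++ b) = 1.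
  by apply/(cP.2 x _); rewrite ?cat_path ?pp//= last_cat lb.
have backE : word c (last x p) b = (word c x p)^-1.
  by apply: (mulIg (word c x p)); rewrite -word_cat closed mulVg.
have := cP.2 (last x p) (b ++ q); rewrite cat_path pb lb pq word_cat lb backE last_cat lb.
move=> /(_ isT) <-; split=> [->|e]; first by rewrite mulgV.
by apply: (mulIg (word c x p)^-1); rewrite e mulgV.
Qed.

Lemma path_of_word x g : exists p, path adj x p /\ word c x p = g.
Proof.
have [s [sE ->]] := gens_gen g.
elim: s sE => [|h s IH] sE; first by exists [::]; rewrite big_nil.
have [p [pp wp]] := IH (fun a hs => sE a (@mem_behead _ (h :: s) a hs)).
have hE : h \in gens Gam by apply: sE; rewrite mem_head.
have [y [[xy yh] _]] := cP.1 (last x p) _ (gens_sym hE).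
exists (rcons p y); rewrite rcons_path pp xy; split=> //.
by rewrite -cats1 word_cat /= mul1g wp big_cons label_inv ?yh ?invgK// adjC.
Qed.

(** Reading group elements along paths from the root identifies the vertices
    with the group; that the identification is well defined and injective is
    the closed-path axiom of a Cayley diagram. *)
Lemma cayley_diagram_aut : exists2 f : aut Gam, f 1 = 1 & c = lab_act f c_st.
Proof.
have /choice[P PP] := path_of_word 1; have /choice[Q QQ] := path_between 1.
pose f u := last 1 (P u); pose h x := word c 1 (Q x).
have fK : cancel f h.
  move=> u; rewrite /h -[RHS](PP u).2; apply/word_endpoint.
  - exact: (QQ _).1.
  - exact: (PP _).1.
  - exact: (QQ _).2.
have hK : cancel h f.
  move=> x; rewrite /f -[RHS](QQ x).2; apply/word_endpoint.
  - exact: (PP _).1.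
  - exact: (QQ _).1.
  - exact: (PP _).2.
have f1 : f 1 = 1.
  rewrite -[RHS]/(last 1 [::]); apply/(word_endpoint (PP 1).1) => //.
  exact: (PP 1).2.
have edge u v y : adj (f u) y -> y = f v <-> edge_label c y (f u) = v * u^-1.
  move=> uy; have py : path adj 1 (rcons (P u) y) by rewrite rcons_path (PP u).1.
  have wy : word c 1 (rcons (P u) y) = edge_label c y (f u) * u.
    by rewrite -cats1 word_cat /= mul1g (PP u).2.
  rewrite -[X in X = f v](last_rcons 1 (P u) y) -(word_endpoint py (PP v).1) wy (PP v).2.
  by split=> [<-|->]; rewrite ?mulgK ?mulgVK.
have f_adj u v : adj (f u) (f v) = adj u v.
  apply/idP/idP => uv.
    have [/(_ erefl) e _] := edge u v (f v) uv.
    by rewrite /adj -e edge_label_gens// adjC.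
  have [y [[uy yE] _]] := cP.1 (f u) _ (gens_sym uv).
  have [_ <-//] := edge u v y uy.
  by rewrite label_inv 1?adjC// yE invgK.
pose F := Aut fK hK f_adj; exists F => //.
apply/funext => e; apply: val_inj; rewrite -edge_labelE -[in RHS]edge_labelE.
rewrite -(hK (val e).1) -(hK (val e).2) -[f]/(F : Gam -> Gam) edge_label_act.
have e12 : adj (h (val e).1) (h (val e).2) by rewrite -f_adj !hK; exact: valP e.
rewrite edge_label_st// /=.
have e21 : adj (f (h (val e).2)) (f (h (val e).1)) by rewrite f_adj adjC.
by have [/(_ erefl)] := edge _ (h (val e).1) _ e21.
Qed.
End Holonomy.

(** Both axioms of a Cayley diagram speak of finitely many edges at a time, so
    they can be checked in a large enough ball. *)
Lemma cayley_diagram_of_balls c : (forall r, ball_iso r c c_st) -> cayley_diagram c.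
Proof.
move=> balls; split=> [x g gE|x p pp].
  have [m xm] := cball_connected x.
  have [phi iso] := balls m.+1; have [psi [iso' phiK psiK]] := is_ball_iso_inv iso.
  have xr : cball m.+1 x by exact: cball_mono xm.
  set u := phi x; have um : cball m u by exact: is_ball_iso_center iso _ xm.
  have ur : cball m.+1 u by exact: cball_mono um.
  have ug : adj u (g^-1 * u) by rewrite adj_mul gens_sym.
  have gr : cball m.+1 (g^-1 * u) by exact: cball_step um ug.
  have xE : x = psi u by rewrite phiK.
  exists (psi (g^-1 * u)); split; first split.
  - by rewrite xE (is_ball_iso_adj iso').
  - rewrite xE (edge_label_ball_iso iso')// edge_label_st//.
    by rewrite invgM invgK mulgA mulgV mul1g.
  - move=> z [xz zg]; have zr : cball m.+1 z by exact: cball_step xm xz.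
    have := edge_label_ball_iso iso xr zr xz; rewrite zg edge_label_st => [e|].
      by rewrite -e invgM invgK mulgVK phiK.
    by rewrite (is_ball_iso_adj iso).
have [m xm] := cball_connected x.
have [phi iso] := balls (m + size p)%N.
have wordE : word c x p = phi (last x p) * (phi x)^-1 /\ cball (m + size p) (last x p).
  elim: p m x xm pp iso => [|y p IH] m x xm /=; first by rewrite addn0 mulgV.
  move=> /andP[xy pp] iso; rewrite addnS -addSn in iso.
  have ym : cball m.+1 y by exact: cball_step xm xy.
  have [-> lr] := IH _ _ ym pp iso; rewrite addnS -addSn; split => //.
  have xr : cball (m.+1 + size p) x by apply: cball_mono xm; lia.
  have yr : cball (m.+1 + size p) y by apply: cball_mono ym; lia.
  rewrite -(edge_label_ball_iso iso) 1?adjC// edge_label_st 1?(is_ball_iso_adj iso) 1?adjC//.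
  by rewrite mulgA mulgVK.
have xr : cball (m + size p) x by apply: cball_mono xm; exact: leq_addr.
have [-> lr] := wordE; split=> [e|<-]; last by rewrite mulgV.
apply: (is_ball_iso_inj iso) => //; apply: (mulIg (phi x)^-1).
by rewrite e mulgV.
Qed.
End CayleyDiagrams.

(** * Measurability *)

Section MeasurableLabellings.
Variables (R : realType) (Gam : markedGroup).
Implicit Types (u v w g : Gam).

Section OneLabelling.
Variables (k : label_kind) (A : finType).
Implicit Types (F : cube R Gam -> labelling Gam k A) (l : labelling Gam k A).

Lemma measurable_label F s (B : set A) : measurable_labelling F ->
  measurable [set x | B (F x s)].
Proof.
move=> mF; apply: (mF [set l | B (l s)]).
by apply: sub_sigma_algebra; exists s, B.
Qed.

Lemma measurable_labellingP F :
  (forall s a, measurable [set x | F x s = a]) -> measurable_labelling F.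
Proof.
move=> mF; suff : <<s [set D : set (labelling Gam k A) |
    exists s (B : set A), D = [set l | B (l s)]] >>
  `<=` [set C | measurable (F @^-1` C)] by [].
apply: smallest_sub.
  split; first by rewrite /= preimage_set0.
    by move=> C /= mC; rewrite setTD preimage_setC; exact: measurableC.
  by move=> C /= mC; rewrite preimage_bigcup; exact: bigcupT_measurable.
move=> _ [s [B ->]] /=.
exact: (measurable_level_sets (f := fun x => F x s) (countableP _) (mF s)).
Qed.

(** An event that depends on finitely many labels is measurable: condition on
    their values one after the other. *)
Lemma measurable_local F (P : set (labelling Gam k A)) (S : seq (site Gam k)) :
  measurable_labelling F ->
  (forall l l', {in S, l =1 l'} -> P l -> P l') -> measurable [set x | P (F x)].
Proof.
move=> mF; elim: S P => [|s S IH] P locP.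
  have [[l Pl]|no] := pselect (exists l, P l).
    rewrite (_ : mkset _ = setT)//; apply/seteqP; split => // x _ /=.
    exact: locP Pl.
  by rewrite (_ : mkset _ = set0)//; apply/seteqP; split => // x /= Px; apply: no; exists (F x).
pose upd l a : labelling Gam k A := fun t => if t == s then a else l t.
have updE l : upd l (l s) = l.
  by apply/funext => t; rewrite /upd; case: eqP => // ->.
rewrite (_ : mkset _ = [set x | P (upd (F x) (F x s))]).
  apply: (measurable_random_index (f := fun x => F x s) (P := fun a => [set x | P (upd (F x) a)])).
  - exact: countableP.
  - by move=> a; exact: (measurable_label s [set b | b = a] mF).
  - move=> a; apply: (IH [set l | P (upd l a)]) => l l' ll' /=; apply: locP => t.
    by rewrite inE /upd; case: eqP => //= _; exact: ll'.
by apply/seteqP; split => x /=; rewrite updE.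
Qed.

Definition ball_sites r : seq (site Gam k) :=
  pmap insub [seq (u, v) | u <- ball_seq r, v <- ball_seq r].

Lemma mem_ball_sites r (s : site Gam k) :
  cball r (val s).1 -> cball r (val s).2 -> s \in ball_sites r.
Proof.
move=> r1 r2; rewrite mem_pmap; apply/mapP; exists (val s); last by rewrite valK.
apply/allpairsP; exists (val s); split; [exact: cball_seq|exact: cball_seq|].
exact: surjective_pairing.
Qed.

Lemma is_ball_iso_local r l1 l2 l1' l2' phi : {in ball_sites r, l1 =1 l1'} ->
  {in ball_sites r, l2 =1 l2'} -> is_ball_iso r l1 l2 phi -> is_ball_iso r l1' l2' phi.
Proof.
move=> e1 e2 [b p a ll]; split => // s t s1 s2 st.
have [fphi _ _] := b; rewrite -e1 ?mem_ball_sites// -e2 ?(ll s)//.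
by apply: mem_ball_sites; rewrite st; exact: fphi.
Qed.

Lemma iso_class_local r l l' : {in ball_sites r, l =1 l'} -> iso_class r l = iso_class r l'.
Proof.
move=> e; apply/iso_classP; exists id.
exact: is_ball_iso_local (fun _ _ => erefl) e (is_ball_iso_id r l).
Qed.

Lemma measurable_iso_class F r (C : set (set (labelling Gam k A))) :
  measurable_labelling F -> measurable [set x | C (iso_class r (F x))].
Proof.
move=> mF; apply: (measurable_local (P := [set l | C (iso_class r l)]) (S := ball_sites r) mF).
by move=> l l' /iso_class_local /= ->.
Qed.

Lemma measurable_ball_iso F r l : measurable_labelling F -> measurable [set x | ball_iso r (F x) l].
Proof.
move=> mF; rewrite (_ : mkset _ = [set x | [set iso_class r l] (iso_class r (F x))]).
  exact: measurable_iso_class.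
by apply/seteqP; split => x /= /iso_classP.
Qed.
End OneLabelling.

Section Walks.
Variable c : cube R Gam -> labelling Gam Edges (gens Gam).
Hypothesis mc : measurable_labelling c.

Definition star_sites x : seq (site Gam Edges) :=
  pmap insub [seq (g * x, x)%g | g <- enum_fset (gens Gam)].

Lemma edge_label_star x y (l l' : labelling Gam Edges (gens Gam)) :
  {in star_sites x, l =1 l'} -> adj x y -> edge_label l y x = edge_label l' y x.
Proof.
move=> ll' xy; have yx : is_site Edges (y, x) by rewrite /= adjC.
pose e : site Gam Edges := Sub (y, x) yx.
rewrite -[y]/(val e).1 -[x]/(val e).2 !edge_labelE ll'// mem_pmap.
apply/mapP; exists (y, x); last by rewrite -[(y, x)]/(val e) valK.
by apply/mapP; exists (y * x^-1)%g; rewrite ?mulgVK.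
Qed.

Lemma measurable_edge_label x y w : measurable [set z | edge_label (c z) x y = w].
Proof.
have [xy|xy] := boolP (adj x y); last first.
  have -> : [set z | edge_label (c z) x y = w] = [set z | 1%g = w].
    by apply/seteqP; split => z; rewrite /= /edge_label insubF//; exact: negbTE.
  exact: (@measurable_const_event _ (cube R Gam) (1%g = w)).
apply: (measurable_local (P := [set l | edge_label l x y = w]) (S := star_sites y) mc).
by move=> l l' ll' /=; rewrite (edge_label_star ll')// adjC.
Qed.

Lemma measurable_step x g w : measurable [set z | step (c z) x g = w].
Proof.
apply: (measurable_local (P := [set l | step l x g = w]) (S := star_sites x) mc).
have spec (l l' : labelling Gam Edges (gens Gam)) y :
    {in star_sites x, l =1 l'} -> step_spec l x g y -> step_spec l' x g y.
  move=> ll' [xy yg un]; split; rewrite -?(edge_label_star ll')// => z xz zg.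
  by apply: un => //; rewrite (edge_label_star ll').
move=> l l' ll' /= /step_level[/(spec _ _ _ ll') Sw|[-> no]]; apply/step_level; first by left.
right; split => // z /spec h; apply: (no z); apply: h => s /ll'.
by move->.
Qed.

Lemma measurable_walk x s w : measurable [set z | walk (c z) x s = w].
Proof.
elim: s w => [|g s IH] w.
  exact: (@measurable_const_event _ (cube R Gam) (x = w)).
exact: (measurable_random_index (f := fun z => walk (c z) x s)
  (P := fun u => [set z | step (c z) u g = w]) (countable_markedGroup Gam) IH
  (fun u => measurable_step u g w)).
Qed.

Lemma measurable_develop x g w : measurable [set z | develop (c z) x g = w].
Proof. exact: measurable_walk. Qed.
End Walks.
End MeasurableLabellings.

(** * Transferring a rule along a diagram *)

Section MeasureBounds.
Local Open Scope ring_scope.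
Local Open Scope ereal_scope.
Variables (d : measure_display) (T : measurableType d) (R : realType).
Variable P : probability T R.

Lemma probability_dist_le (A B N : set T) : measurable A -> measurable B -> measurable N ->
  (forall x, ~ N x -> A x <-> B x) -> `|P A - P B| <= P N.
Proof.
move=> mA mB mN AB.
have half (C D : set T) : measurable C -> measurable D ->
    (forall x, ~ N x -> C x -> D x) -> P C - P D <= P N.
  move=> mC mD CD; rewrite leeBlDl ?fin_num_measure//.
  apply: (le_trans _ (measureU2 P mD mN)).
  apply: le_measure; rewrite ?inE//; first exact: measurableU.
  by move=> x Cx; have [Nx|Nx] := pselect (N x); [right|left; exact: CD].
have h1 := half A B mA mB (fun x Nx => (AB x Nx).1).
have h2 := half B A mB mA (fun x Nx => (AB x Nx).2).
have fine_P C : measurable C -> exists r : R, P C = r%:E.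
  by move=> mC; exists (fine (P C)); rewrite fineK// fin_num_measure.
have [a ea] := fine_P A mA; have [b eb] := fine_P B mB; have [n en] := fine_P N mN.
move: h1 h2; rewrite ea eb en -!EFinB !lee_fin => h1 h2.
by rewrite ler_norml; lra.
Qed.

Lemma probability_seq_union (I : eqType) (S : seq I) (E : I -> set T) (delta : R) :
  (forall i, measurable (E i)) -> (forall i, P (E i) <= delta%:E) ->
  measurable [set x | exists2 i, i \in S & E i x] /\
  P [set x | exists2 i, i \in S & E i x] <= ((size S)%:R * delta)%:E.
Proof.
move=> mE dE; elim: S => [|i S [mS IH]].
  rewrite (_ : mkset _ = set0); last by apply/seteqP; split => // x [].
  by rewrite measure0 mul0r.
rewrite (_ : mkset _ = E i `|` [set x | exists2 j, j \in S & E j x]); last first.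
  apply/seteqP; split => x /= => [[j]|[Ex|[j jS Ex]]].
  - by rewrite inE => /orP[/eqP->|jS] Ex; [left|right; exists j].
  - by exists i => //; rewrite mem_head.
  - by exists j => //; rewrite inE jS orbT.
split; first exact: measurableU.
apply: le_trans (measureU2 P (mE i) mS) _.
by rewrite /= -natr1 mulrDl mul1r EFinD addeC; apply: leeD.
Qed.
End MeasureBounds.

Section RootSites.
Context {Gam : markedGroup} (k : label_kind).
Local Open Scope group_scope.
Implicit Types (u w : Gam) (c : labelling Gam Edges (gens Gam)) (s t : site Gam k).

Definition root_label c u w : Gam := if u == w then 1 else edge_label c w u.

Lemma site_adj u w : is_site k (u, w) -> u != w -> adj u w.
Proof. by case: k => /= [->//|//|/orP[->|//]]. Qed.

Lemma root_label_site c s : is_site k (1, root_label c (val s).1 (val s).2).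
Proof.
rewrite /root_label; case: s => -[u w] /=.
case: k => /=; rewrite /adj.
- by move=> ->.
- move=> uw; case: eqP => [e|_]; last by rewrite invg1 mulg1 edge_label_gens// adjC.
  by move: uw; rewrite e mulgV (negbTE (gens_id Gam)).
- case: eqP => [_ _|_ /=]; first by rewrite eqxx.
  by move=> uw; rewrite invg1 mulg1 edge_label_gens ?orbT// adjC.
Qed.

(** The site at the root that occupies, in the reading of c from the first
    endpoint of s, the place of s. *)
Definition root_site c s : site Gam k :=
  Sub (1, root_label c (val s).1 (val s).2) (root_label_site c s).

Lemma root_site_act c (f : aut Gam) s : root_site (lab_act f c) (site_act f s) = root_site c s.
Proof.
by apply: val_inj; rewrite /= /root_label (can_eq (aut_funK f)) edge_label_act.
Qed.

Lemma root_site_ball_iso r c phi s t : is_ball_iso r c_st c phi ->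
  cball r (val s).1 -> cball r (val s).2 -> val t = (phi (val s).1, phi (val s).2) ->
  root_site c t = root_site c_st s.
Proof.
move=> iso r1 r2 e; apply: val_inj; rewrite /= e /root_label /=; congr (_, _).
have -> : (phi (val s).1 == phi (val s).2) = ((val s).1 == (val s).2).
  by apply/eqP/eqP => [|->//]; exact: (is_ball_iso_inj iso).
case: ifPn => // s12; rewrite (edge_label_ball_iso iso)// adjC.
by apply: site_adj => //; rewrite -surjective_pairing; exact: valP.
Qed.

Lemma val_root_site_st s : val (root_site c_st s) = (1, (val s).2 * (val s).1^-1).
Proof.
rewrite /= /root_label; case: eqP => [->|/eqP s12]; first by rewrite mulgV.
by rewrite edge_label_st// adjC; apply: site_adj => //; rewrite -surjective_pairing; exact: valP.
Qed.

Lemma countable_site : countable [set: site Gam k].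
Proof.
have /countable_injP[f fi] : countable [set: Gam * Gam].
  rewrite (_ : setT = [set: Gam] `*` [set: Gam]); last by apply/seteqP; split.
  by apply: countableX; exact: countable_markedGroup.
apply/countable_injP; exists (f \o val) => s t _ _ e; apply: val_inj.
by apply: fi; rewrite ?inE.
Qed.
End RootSites.

Section Transfer.
Variables (R : realType) (Gam : markedGroup) (k : label_kind) (A : finType).
Local Open Scope ring_scope.
Local Open Scope ereal_scope.
Implicit Types (u v w g : Gam).

(** The labelling that reads at each site the rule rho through the diagram c:
    half of the randomness produces c, and the other half, seen from the site in
    the coordinates that c provides, is fed to rho. *)
Definition transfer (c : cube R Gam -> labelling Gam Edges (gens Gam))
    (rho : site Gam k -> cube R Gam -> A) (x : cube R Gam) : labelling Gam k A :=
  fun s => rho (root_site (c (left_half x)) s)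
    (cube_comp (develop (c (left_half x)) (val s).1) (right_half x)).

Variables (c : cube R Gam -> labelling Gam Edges (gens Gam))
  (rho : site Gam k -> cube R Gam -> A).
Hypothesis mc : measurable_labelling c.
Hypothesis mrho : forall t a, measurable [set y | rho t y = a].

Lemma measurable_root_site (s t : site Gam k) : measurable [set z | root_site (c z) s = t].
Proof.
have lab w : measurable [set z | root_label (c z) (val s).1 (val s).2 = w].
  rewrite /root_label; case: ((val s).1 == (val s).2); last exact: measurable_edge_label.
  exact: measurable_const_event.
rewrite (_ : mkset _ = [set z | [set w | (1%g, w) = val t] (root_label (c z) (val s).1 (val s).2)]).
  exact: (measurable_level_sets (f := fun z => root_label (c z) (val s).1 (val s).2)
    (countable_markedGroup Gam) lab).
apply/seteqP; split => z /= e; last exact: val_inj.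
by rewrite -e.
Qed.

Lemma measurable_transfer : measurable_labelling (transfer c rho).
Proof.
apply: measurable_labellingP => s a.
apply: (measurable_random_index (f := fun x => root_site (c (left_half x)) s)
  (P := fun t => [set x |
     rho t (cube_comp (develop (c (left_half x)) (val s).1) (right_half x)) = a])).
- exact: countable_site.
- move=> t; apply: (measurable_pre (f := @left_half R Gam) (C := [set z | root_site (c z) s = t])).
    exact: measurable_digits_part.
  exact: measurable_root_site.
- move=> t; apply: (measurable_pre
    (f := fun x => cube_comp (develop (c (left_half x)) (val s).1) (right_half x))
    (C := [set y | rho t y = a])) => //.
  apply: measurable_random_cube_comp; last exact: measurable_digits_part.
  move=> v w; apply: (measurable_pre (f := @left_half R Gam)
    (C := [set z | develop (c z) (val s).1 v = w])); first exact: measurable_digits_part.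
  exact: measurable_develop.
Qed.

Variable lam : probability (cube R Gam) R.
Hypothesis lamP : is_product_lebesgue lam.

Lemma ae_left_half (Q : cube R Gam -> Prop) : {ae lam, forall x, Q x} ->
  {ae lam, forall x, Q (left_half x)}.
Proof.
move=> [N [mN N0 QN]]; exists (@left_half R Gam @^-1` N); split.
- by apply: measurable_pre => //; exact: measurable_digits_part.
- by rewrite -N0; exact: left_half_law.
- by move=> x nQ; exact: QN.
Qed.

(** The construction refers to nothing but the graph and the two labellings, so
    it commutes with every automorphism that c commutes with. *)
Lemma fiid_transfer : fiid lam (@AutK Gam) c -> fiid lam (@AutK Gam) (transfer c rho).
Proof.
move=> [_ ec]; split; first exact: measurable_transfer.
move=> f Kf; have := ae_left_half (ec f Kf); apply: filterS => x cx.
apply/funext => s; pose s' := site_act (aut_inverse f) s.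
have -> : s = site_act f s'.
  by apply: val_inj; rewrite /= !aut_invK -surjective_pairing.
rewrite /lab_act /transfer; have -> : left_half (cube_act f x) = cube_act f (left_half x) by [].
rewrite cx root_site_act.
have -> : site_act (aut_inverse f) (site_act f s') = s'.
  by apply: val_inj; rewrite /= !aut_funK.
congr (rho _ _); apply/funext => v; rewrite /cube_comp.
rewrite [(val (site_act f s')).1](_ : _ = f (val s').1)// develop_act.
have -> : right_half (cube_act f x) = cube_act f (right_half x) by [].
by rewrite /cube_act aut_funK.
Qed.

(** If outside a small event D the map Phi z is an isomorphism of r-balls from
    the standard diagram to c z that c z also develops correctly, as far as rho
    looks, then transferring rho amounts to relabelling by Phi the labelling F
    of the point Y obtained by pulling the second half back along Phi; and Y is
    distributed as a uniform point. *)
Lemma transfer_stats (F : cube R Gam -> labelling Gam k A) (r : nat)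
    (Phi : cube R Gam -> Gam -> Gam) (D : set (cube R Gam)) (delta : R) :
  measurable_labelling F -> measurable D ->
  (forall z, bijective (Phi z)) -> (forall v w, measurable [set z | Phi z v = w]) ->
  (forall z, ~ D z -> is_ball_iso r c_st (c z) (Phi z)) ->
  (forall z u t y, ~ D z -> cball r u ->
     rho t (cube_comp (develop (c z) (Phi z u)) y) =
     rho t (cube_comp (fun g => Phi z (g * u)%g) y)) ->
  (forall s, lam [set y | rho (root_site c_st s) (cube_comp (fun g => (g * (val s).1)%g) y)
                          <> F y s] <= delta%:E) ->
  forall C, `|local_stats lam r F C - local_stats lam r (transfer c rho) C| <=
    lam D + ((size (@ball_sites Gam k r))%:R * delta)%:E.
Proof.
move=> mF mD bPhi mPhi isoD rhoD rhoF C.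
pose Y x := cube_comp (Phi (left_half x)) (right_half x).
have mleft := measurable_digits_part high_bits_lt : measurable_fun setT (@left_half R Gam).
have mY : measurable_fun setT Y.
  apply: measurable_random_cube_comp; last exact: measurable_digits_part.
  by move=> v w; exact: (measurable_pre (C := [set z | Phi z v = w]) mleft).
pose E s := [set y | rho (root_site c_st s) (cube_comp (fun g => (g * (val s).1)%g) y) <> F y s].
have mE s : measurable (E s).
  apply: measurable_mismatch; first exact: countableP.
    by move=> a; exact: (measurable_label s [set b | b = a] mF).
  move=> a; apply: (measurable_pre (f := @cube_comp R Gam (fun g => (g * (val s).1)%g))
    (C := [set y | rho (root_site c_st s) y = a])) => //.
  by apply: measurable_to_cube => v; exact: measurable_coord.
pose Bad := @left_half R Gam @^-1` D `|` [set x | exists2 s, s \in @ball_sites Gam k r & E s (Y x)].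
have mEY s : measurable [set x | E s (Y x)] by exact: measurable_pre.
have law (B : set (cube R Gam)) : measurable B -> lam [set x | B (Y x)] = lam B.
  exact: law_random_cube_comp.
have [mU leU] := @probability_seq_union _ _ _ lam _ (@ball_sites Gam k r)
  (fun s => [set x | E s (Y x)]) delta mEY
  (fun s => eq_ind_r (fun p => p <= _) (rhoF s) (law _ (mE s))).
have mstats (G : cube R Gam -> labelling Gam k A) : measurable_labelling G ->
    measurable [set x | C (iso_class r (G x))].
  exact: measurable_iso_class.
have mB : measurable Bad by apply: measurableU => //; exact: measurable_pre.
rewrite /local_stats -(law [set x | C (iso_class r (F x))]); last exact: mstats.
apply: (@le_trans _ _ (lam Bad)); last first.
  apply: le_trans (measureU2 _ _ _) _ => //; first exact: measurable_pre.
  by apply: leeD leU; have /eqP := left_half_law lamP mD; rewrite eq_le => /andP[].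
apply: probability_dist_le => //.
- by apply: (measurable_pre (f := Y) (C := [set y | C (iso_class r (F y))])) => //; exact: mstats.
- by apply: mstats; exact: measurable_transfer.
- move=> x good /=; suff -> : iso_class r (F (Y x)) = iso_class r (transfer c rho x) by [].
  apply/iso_classP; exists (Phi (left_half x)).
  have nD : ~ D (left_half x) by move=> Dx; apply: good; left.
  have iso := isoD _ nD; have [bphi phi1 phi_adj _] := iso; split => // s t s1 s2 st.
  have -> : F (Y x) s = rho (root_site c_st s) (cube_comp (fun g => (g * (val s).1)%g) (Y x)).
    apply: contrapT => ne; apply: good; right; exists s; first exact: mem_ball_sites.
    by move=> e; apply: ne; rewrite e.
  rewrite /transfer (root_site_ball_iso iso s1 s2 st) st /= rhoD//.
Qed.
End Transfer.

(** * Finitary approximation *)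

Lemma cvg_ex_ge (R : realType) (f : nat -> \bar R) (l delta : R) :
  (f @ \oo --> l%:E)%E -> (0 < delta)%R -> exists n, ((l - delta)%:E <= f n)%E.
Proof.
move=> fl d0; apply: contrapT => no.
have : (l%:E <= (l - delta)%:E)%E.
  apply: (cvge_to_le fl); apply: nearW => n; rewrite leNgt; apply/negP => h.
  by apply: no; exists n; exact: ltW.
by rewrite lee_fin; lra.
Qed.

Section FinitaryApproximation.
Variables (R : realType) (Gam : markedGroup).
Local Open Scope ring_scope.
Local Open Scope ereal_scope.
Variable lam : probability (cube R Gam) R.
Implicit Types (E H : set (cube R Gam)).

Definition depends_on_ball (T : Type) n (f : cube R Gam -> T) : Prop :=
  forall y y' : cube R Gam, (forall v, cball n v -> y v = y' v) -> f y = f y'.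

Lemma depends_on_ball_mono T n m (f : cube R Gam -> T) : (n <= m)%N ->
  depends_on_ball n f -> depends_on_ball m f.
Proof. by move=> nm nf y y' e; apply: nf => v nv; apply: e; exact: cball_mono nv. Qed.

Let differ E H := [set y : cube R Gam | ~ (E y <-> H y)].

Let measurable_differ E H : measurable E -> measurable H -> measurable (differ E H).
Proof.
move=> mE mH; rewrite (_ : differ E H = (E `\` H) `|` (H `\` E)).
  by apply: measurableU; exact: measurableD.
apply/seteqP; split => y; rewrite /setU /setD /differ /=; last tauto.
by have [Ey|Ey] := pselect (E y); have [Hy|Hy] := pselect (H y); tauto.
Qed.

Definition finitarily_approximable E : Prop := measurable E /\
  forall delta : R, (0 < delta)%R -> exists n H,
    [/\ measurable H, depends_on_ball n H & lam (differ E H) <= delta%:E].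

Let approx_trans E : measurable E ->
  (forall delta : R, (0 < delta)%R -> exists2 H, finitarily_approximable H &
     lam (differ E H) <= delta%:E) -> finitarily_approximable E.
Proof.
move=> mE app; split => // delta d0; have d2 : (0 < delta / 2)%R by rewrite divr_gt0.
have [H [mH /(_ _ d2)[n [K [mK nK HK]]]] EH] := app _ d2.
exists n, K; split => //.
apply: (@le_trans _ _ (lam (differ E H `|` differ H K))).
  apply: le_measure; rewrite ?inE.
  - exact: measurable_differ.
  - by apply: measurableU; exact: measurable_differ.
  - by move=> y /= EK; have [e|] := pselect (E y <-> H y); [right=> e'; apply: EK; tauto|left].
apply: le_trans (measureU2 lam (measurable_differ mE mH) (measurable_differ mH mK)) _.
by rewrite [X in _ <= X%:E]splitr EFinD; exact: leeD.
Qed.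

Let approxU E H : finitarily_approximable E -> finitarily_approximable H ->
  finitarily_approximable (E `|` H).
Proof.
move=> [mE aE] [mH aH]; split=> [|delta d0]; first exact: measurableU.
have d2 : (0 < delta / 2)%R by rewrite divr_gt0.
have [n [E' [mE' nE' EE']]] := aE _ d2; have [m [H' [mH' nH' HH']]] := aH _ d2.
exists (maxn n m), (E' `|` H'); split.
- exact: measurableU.
- move=> y y' e; rewrite /setU /=.
  rewrite (depends_on_ball_mono (leq_maxl n m) nE' e).
  by rewrite (depends_on_ball_mono (leq_maxr n m) nH' e).
apply: (@le_trans _ _ (lam (differ E E' `|` differ H H'))).
  apply: le_measure; rewrite ?inE.
  - by apply: measurable_differ; exact: measurableU.
  - by apply: measurableU; exact: measurable_differ.
  - move=> y /= d; have [e|] := pselect (E y <-> E' y); last by left.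
    by right=> e'; apply: d; rewrite /setU /=; tauto.
apply: le_trans (measureU2 lam (measurable_differ mE mE') (measurable_differ mH mH')) _.
by rewrite [X in _ <= X%:E]splitr EFinD; exact: leeD.
Qed.

Let approx_bigcup (E : nat -> set (cube R Gam)) :
  (forall n, finitarily_approximable (E n)) -> finitarily_approximable (\bigcup_n E n).
Proof.
move=> aE; have mE n : measurable (E n) by have [] := aE n.
apply: approx_trans => [|delta d0]; first by apply: bigcupT_measurable.
pose U n := \big[setU/set0]_(i < n.+1) E i.
have mU n : measurable (U n) by apply: bigsetU_measurable => i _.
have UE : \bigcup_n U n = \bigcup_n E n by exact: bigcup_bigsetU_bigcup.
have cvgU : lam \o U @ \oo --> lam (\bigcup_n E n).
  rewrite -UE; apply: nondecreasing_cvg_mu => //; first exact: bigcupT_measurable.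
  by move=> n m nm; apply/subsetPset; exact: subset_bigsetU.
have mUE : measurable (\bigcup_n E n) by exact: bigcupT_measurable.
have [n nd] : exists n, lam (\bigcup_n E n) - lam (U n) <= delta%:E.
  move: cvgU; rewrite -[lam (\bigcup_n E n)]fineK ?fin_num_measure// => /cvg_ex_ge/(_ d0)[n nd].
  exists n; rewrite leeBlDr ?fin_num_measure// -leeBlDl//.
exists (U n).
  rewrite /U; elim: (n.+1) => [|m IH]; first rewrite big_ord0.
    split=> // e e0; exists 0%N, set0; split => //.
    rewrite (_ : differ _ _ = set0) ?measure0 ?lee_fin ?ltW//.
    by apply/seteqP; split => // y /=; apply.
  by rewrite big_ord_recr; exact: approxU.
rewrite (_ : differ _ _ = (\bigcup_n E n) `\` U n).
  rewrite (measureD mUE (mU n)) ?ltey_eq ?fin_num_measure// setIidr//.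
  by rewrite -UE; exact: bigcup_sup.
apply/seteqP; split => y; rewrite /setD /differ /=; last tauto.
  have UnE : U n y -> (\bigcup_n E n) y by move=> Uy; rewrite -UE; exists n.
  by have [Uy|Uy] := pselect (U n y); have [Ey|Ey] := pselect ((\bigcup_n E n) y); tauto.
Qed.

(** The events that can be approximated by events depending on a ball form a
    sigma-algebra: a countable union is, up to small measure, a finite one. *)
Lemma measurable_approximable E : measurable E -> finitarily_approximable E.
Proof.
move: E; apply: smallest_sub.
  split.
  - split=> // delta d0; exists 0%N, set0; split => //.
    rewrite (_ : differ _ _ = set0) ?measure0 ?lee_fin ?ltW//.
    by apply/seteqP; split => // y /=; apply.
  - move=> E [mE aE]; rewrite setTD; split=> [|delta]; first exact: measurableC.
    move=> /aE[n [H [mH nH EH]]].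
    exists n, (~` H); split; [exact: measurableC|by move=> y y' e; rewrite /setC /= (nH y y' e)|].
    rewrite (_ : differ _ _ = differ E H)//; apply/seteqP; split => y;
      rewrite /differ /setC /= => d e; apply: d;
      have [Ey|Ey] := pselect (E y); have [Hy|Hy] := pselect (H y); tauto.
  - exact: approx_bigcup.
move=> _ [v [B [mB ->]]].
have mC : measurable [set x : cube R Gam | B ((x v)%:num)%R].
  by apply: sub_sigma_algebra; exists v, B.
split=> // delta d0; have [n nv] := cball_connected v.
exists n, [set x : cube R Gam | B ((x v)%:num)%R]; split => //.
  by move=> y y' e /=; rewrite e.
rewrite (_ : differ _ _ = set0) ?measure0 ?lee_fin ?ltW//.
by apply/seteqP; split => // y /=; apply.
Qed.

(** Approximate the level sets of f separately; where the approximations are all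
    correct, exactly one of them contains y. *)
Lemma approximate_finite_valued (A : finType) (f : cube R Gam -> A) (delta : R) :
  (forall a, measurable [set y | f y = a]) -> (0 < delta)%R ->
  exists n g, [/\ forall a, measurable [set y | g y = a], depends_on_ball n g &
    lam [set y | g y <> f y] <= delta%:E].
Proof.
move=> mf d0; pose N := #|A|.
have N0 : (0 < N)%N by apply/card_gt0P; exists (f point).
have dN : (0 < delta / N%:R)%R by rewrite divr_gt0// ltr0n.
have /choice[p pP] (a : A) : exists p : nat * set (cube R Gam),
    [/\ measurable p.2, depends_on_ball p.1 p.2 &
        lam (differ [set y | f y = a] p.2) <= (delta / N%:R)%:E].
  have [_ /(_ _ dN)[n [H HP]]] := measurable_approximable (mf a).
  by exists (n, H).
pose profile (y : cube R Gam) := [ffun a => `[< (p a).2 y >]].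
pose decode (b : {ffun A -> bool}) := if [pick a | b a] is Some a then a else f point.
have mprofile b : measurable [set y | profile y = b].
  rewrite (_ : mkset _ = \bigcap_(a in [set` [set: A]%SET])
      (if b a then (p a).2 else ~` (p a).2)).
    apply: fin_bigcap_measurable => [|a' _]; first exact: finite_finset.
    have [ma' _ _] := pP a'; case: (b a') => //; exact: measurableC.
  apply/seteqP; split => y /=.
    by move=> <- a' _; rewrite /profile ffunE; case: asboolP.
  move=> h; apply/ffunP => a'; rewrite ffunE; have := h a'.
  by rewrite /= inE => /(_ isT); case: (b a') => ?; apply/asboolP.
have mg a : measurable [set y | (decode \o profile) y = a].
  exact: (measurable_level_sets (countableP _) mprofile [set b | decode b = a]).
exists (\max_a (p a).1), (decode \o profile); split.
- exact: mg.
- move=> y y' e /=; congr decode; apply/ffunP => a; rewrite !ffunE.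
  have [_ na _] := pP a.
  by rewrite (depends_on_ball_mono (leq_bigmax a) na e).
have mD a : measurable (differ [set y | f y = a] (p a).2).
  by have [ma _ _] := pP a; exact: measurable_differ.
have [mU leU] := probability_seq_union (enum A) mD (fun a => let: And3 _ _ h := pP a in h).
apply: (@le_trans _ _ (lam [set y | exists2 a, a \in enum A & differ [set y | f y = a] (p a).2 y])).
  apply: le_measure; rewrite ?inE//.
    by apply: measurable_mismatch; first exact: countableP.
  move=> y /= ne; apply: contrapT => no; apply: ne.
  have ok a : f y = a <-> (p a).2 y.
    by apply: contrapT => d; apply: no; exists a => //; rewrite mem_enum.
  rewrite /decode; case: pickP => [a|/(_ (f y))]; rewrite ffunE.
    by move=> /asboolP /ok.
  by move=> /asboolP[]; exact/ok.
apply: le_trans leU _; rewrite lee_fin -cardE -/N mulrCA divff ?mulr1//.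
by rewrite gt_eqF// ltr0n.
Qed.

(** Only the sites of S need a good approximation; elsewhere the rule can be
    constant, and then one radius serves for all sites. *)
Lemma approximate_rule (k : label_kind) (A : finType) (F : cube R Gam -> labelling Gam k A)
    (delta : R) (S : seq (site Gam k)) : measurable_labelling F -> (0 < delta)%R ->
  exists n (rho : site Gam k -> cube R Gam -> A),
    [/\ forall t a, measurable [set y | rho t y = a], forall t, depends_on_ball n (rho t) &
      forall t, t \in S -> lam [set y | rho t y <> F y t] <= delta%:E].
Proof.
move=> mF d0.
have /choice[p pP] (t : site Gam k) : exists p : nat * (cube R Gam -> A),
    [/\ forall a, measurable [set y | p.2 y = a], depends_on_ball p.1 p.2 &
      lam [set y | p.2 y <> F y t] <= delta%:E].
  have [|n [g h]] := @approximate_finite_valued A (fun y => F y t) delta _ d0.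
    by move=> a; exact: (measurable_label t [set b | b = a] mF).
  by exists (n, g).
exists (\max_(t <- S) (p t).1), (fun t => if t \in S then (p t).2 else fun=> F point t); split.
- move=> t a; case: ifP => _; first by have [] := pP t.
  exact: measurable_const_event.
- move=> t; case: ifP => // tS; have [_ nt _] := pP t.
  by apply: depends_on_ball_mono nt; exact: leq_bigmax_seq.
- by move=> t tS; rewrite tS; have [] := pP t.
Qed.
End FinitaryApproximation.

(** * The two equivalences *)

Section BallExtension.
Context {Gam : markedGroup} (k : label_kind) (A : Type).
Implicit Types (l : labelling Gam k A).

(** A ball isomorphism permutes its ball, hence extends by the identity to a
    permutation of the whole group. *)
Lemma is_ball_iso_extend r l l' (phi : Gam -> Gam) : is_ball_iso r l l' phi ->
  let phi' v := if `[< cball r v >] then phi v else v in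
  bijective phi' /\ is_ball_iso r l l' phi'.
Proof.
move=> iso /=; set phi' := fun v => _.
have [psi [iso' phiK psiK]] := is_ball_iso_inv iso.
have phiE v : cball r v -> phi' v = phi v by rewrite /phi' => rv; case: asboolP.
split.
  exists (fun v => if `[< cball r v >] then psi v else v) => v; rewrite /phi'.
    case: (asboolP (cball r v)) => rv; case: asboolP => // rv'; first exact: phiK.
    by case: rv'; exact: is_ball_iso_center iso (leqnn r) rv.
  case: (asboolP (cball r v)) => rv; case: asboolP => // rv'; first exact: psiK.
  by case: rv'; exact: is_ball_iso_center iso' (leqnn r) rv.
have [[f i s] p a ll] := iso; split; first split.
- by move=> v rv; rewrite phiE//; exact: f.
- by move=> u v /[!inE] ru rv; rewrite !phiE//; exact: is_ball_iso_inj iso ru rv.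
- by move=> v /s[u ru <-]; exists u; rewrite ?phiE.
- by rewrite phiE//; exact: cball1.
- by move=> u v /[!inE] ru rv; rewrite !phiE//; exact: is_ball_iso_adj iso ru rv.
- by move=> s' t r1 r2; rewrite !phiE//; exact: ll.
Qed.
End BallExtension.

Section Main.
Variables (R : realType) (Gam : markedGroup).
Local Open Scope ring_scope.
Local Open Scope ereal_scope.
Variable lam : probability (cube R Gam) R.
Hypothesis lamP : is_product_lebesgue lam.

Section FromDiagrams.
Variables (k : label_kind) (A : finType) (F : cube R Gam -> labelling Gam k A).
Hypothesis FP : fiid lam (@GammaK Gam) F.

(** By equivariance under translations the label of F at a site is its label at
    a root site, read in the translated configuration; so a rule that mostly
    agrees with F at the root mostly agrees with it everywhere. *)
Lemma rule_error (rho : site Gam k -> cube R Gam -> A) (delta : R) (s : site Gam k) :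
  (forall t a, measurable [set y | rho t y = a]) ->
  lam [set y | rho (root_site c_st s) y <> F y (root_site c_st s)] <= delta%:E ->
  lam [set y | rho (root_site c_st s) (cube_comp (fun g => (g * (val s).1)%g) y) <> F y s]
    <= delta%:E.
Proof.
move=> mrho; set t := root_site c_st s; set u := (val s).1 => small.
have [mF eF] := FP.
have mFs s' a : measurable [set y | F y s' = a].
  exact: (measurable_label s' [set b | b = a] mF).
pose tr := @cube_comp R Gam (fun g => (g * u)%g).
have mtr : measurable_fun setT tr.
  by apply: measurable_to_cube => v; exact: measurable_coord.
have mE : measurable [set y | rho t y <> F y t].
  by apply: measurable_mismatch => //; exact: countableP.
have law : lam (tr @^-1` [set y | rho t y <> F y t]) = lam [set y | rho t y <> F y t].
  by apply: (law_cube_comp lamP (g := fun g => (g * u^-1)%g)) mE => g; rewrite ?mulgK ?mulgVK.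
have [N [mN N0 FN]] := eF (translate u) (imageT _ u).
rewrite -law in small.
apply: le_trans small; rewrite -[leRHS]adde0 -N0.
apply: le_trans (measureU2 lam (measurable_pre mtr mE) mN).
apply: le_measure; rewrite ?inE.
- apply: measurable_mismatch; [exact: countableP|exact: mFs|].
  by move=> a; apply: (measurable_pre (f := tr) (C := [set y | rho t y = a])).
- by apply: measurableU => //; exact: measurable_pre.
move=> y /= ne; have [Ny|Ny] := pselect (N y); [by right|left => e; apply: ne].
have Fy : F (cube_act (translate u) y) = lab_act (translate u) (F y).
  by apply: contrapT => h; apply: Ny; exact: FN.
rewrite -/tr e [tr y](_ : _ = cube_act (translate u) y)// Fy /lab_act; congr (F y _).
apply: val_inj; have vt : val t = (1%g, ((val s).2 * u^-1)%g) by exact: val_root_site_st.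
rewrite -[LHS]/((val t).1 * u, (val t).2 * u)%g vt /= mul1g mulgVK.
by rewrite -surjective_pairing.
Qed.

(** An exact diagram is developed by automorphisms of the whole graph, so F can be
    transferred as it stands and no error occurs. *)
Lemma diagram_stats : has_fiid_cayley_diagram lam ->
  exists F' : cube R Gam -> labelling Gam k A,
    fiid lam (@AutK Gam) F' /\ same_local_stats lam F F'.
Proof.
move=> [c [cfiid [D [mD D0 cD]]]]; have [mF _] := FP; have [mc _] := cfiid.
have mFs s a : measurable [set y | F y s = a].
  exact: (measurable_label s [set b | b = a] mF).
exists (transfer c (fun t y => F y t)); split; first exact: fiid_transfer.
move=> r; apply/funext => C.
pose Phi z v := if `[< D z >] then v else develop (c z) 1%g v.
have good z : ~ D z -> exists2 f : aut Gam, f 1%g = 1%g &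
    c z = lab_act f c_st /\ forall u g, develop (c z) (f u) g = f (g * u)%g.
  move=> nD; have /cayley_diagram_aut[f f1 cE] : cayley_diagram (c z).
    by apply: contrapT => h; apply: nD; exact: cD.
  exists f => //; split => // u g.
  have [m um] := cball_connected u; have [n gn] := cball_connected g.
  by rewrite cE (develop_ball_iso (is_ball_iso_aut (m + n) c_st f1) um gn).
have PhiE z : ~ D z -> exists2 f : aut Gam, f 1%g = 1%g & [/\ Phi z = f,
    c z = lab_act f c_st & forall u g, develop (c z) (f u) g = f (g * u)%g].
  move=> nD; have [f f1 [cE dev]] := good z nD; exists f => //; split => //.
  by apply/funext => v; rewrite /Phi; case: asboolP => // _; rewrite -{1}f1 dev mulg1.
have bPhi z : bijective (Phi z).
  have [Dz|nD] := pselect (D z); last first.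
    by have [f _ [-> _ _]] := PhiE z nD; exists (aut_inv f); [exact: aut_funK|exact: aut_invK].
  by exists id => v; rewrite /Phi; case: asboolP.
have mPhi v w : measurable [set z | Phi z v = w].
  rewrite (_ : mkset _ = (D `&` [set z | v = w]) `|` ([set z | develop (c z) 1%g v = w] `\` D)).
    apply: measurableU; last by apply: measurableD => //; exact: measurable_develop.
    by apply: measurableI => //; exact: measurable_const_event.
  by apply/seteqP; split => z /=; rewrite /Phi; case: asboolP => Dz; tauto.
have isoD z : ~ D z -> is_ball_iso r c_st (c z) (Phi z).
  by move=> /PhiE[f f1 [-> -> _]]; exact: is_ball_iso_aut.
have rhoD z u t y : ~ D z -> cball r u ->
    F (cube_comp (develop (c z) (Phi z u)) y) t =
    F (cube_comp (fun g => Phi z (g * u)%g) y) t.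
  move=> /PhiE[f f1 [-> cE dev]] _; congr (F _ _); apply/funext => g.
  by rewrite /cube_comp dev.
have rhoF s : lam [set y | F (cube_comp (fun g => (g * (val s).1)%g) y) (root_site c_st s) <> F y s]
    <= 0%:E.
  apply: (rule_error (rho := fun t y => F y t)) => //.
  by rewrite (_ : mkset _ = set0) ?measure0//; apply/seteqP; split => // y /=; apply.
have := @transfer_stats R Gam k A c (fun t y => F y t) mc (fun t => mFs t) lam lamP F r
  Phi D 0 mF mD bPhi mPhi isoD rhoD rhoF C.
have fin (G : cube R Gam -> labelling Gam k A) : measurable_labelling G ->
    exists q : R, local_stats lam r G C = q%:E.
  move=> mG; exists (fine (local_stats lam r G C)).
  by rewrite fineK// fin_num_measure//; exact: measurable_iso_class.
have [a ->] := fin F mF.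
have [b ->] := fin _ (measurable_transfer mc (fun t => mFs t)).
rewrite D0 mulr0 add0e -EFinB lee_fin normr_le0 subr_eq0 => /eqP ->.
by [].
Qed.

(** An approximate diagram is only developed correctly in a ball, so F has to be
    replaced by a rule of finite radius n first.  Half of eps pays for that, and
    the other half for the event that the ball of radius r + n is wrong. *)
Lemma approx_diagram_stats : has_fiid_approx_cayley_diagram lam ->
  forall (r : nat) (eps : R), (0 < eps)%R ->
  exists F' : cube R Gam -> labelling Gam k A,
    fiid lam (@AutK Gam) F' /\
    tv_dist (local_stats lam r F) (local_stats lam r F') <= eps%:E.
Proof.
move=> [c [cfiid ccvg]] r eps eps0; have [mF _] := FP.
pose N := (size (@ball_sites Gam k r)).+1.
have e2 : (0 < eps / 2)%R by rewrite divr_gt0.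
have eN : (0 < eps / 2 / N%:R)%R by rewrite divr_gt0// ltr0n.
have [n [rho [mrho nrho rhoF]]] := approximate_rule lam (@ball_sites Gam k 1) mF eN.
pose M := (r + n)%N.
have [i ci] := cvg_ex_ge (ccvg M) e2.
have [mc _] := cfiid i.
exists (transfer (c i) rho); split; first exact: fiid_transfer.
pose D := ~` [set z | ball_iso M (c i z) c_st].
have mD : measurable D by apply: measurableC; exact: measurable_ball_iso.
have lamD : lam D <= (eps / 2)%:E.
  rewrite probability_setC; last exact: measurable_ball_iso.
  rewrite leeBlDr; last by rewrite fin_num_measure//; exact: measurable_ball_iso.
  by rewrite -leeBlDl// -EFinB.
pose Phi z v := if `[< D z >] then v else if `[< cball M v >] then develop (c i z) 1%g v else v.
have PhiE z : ~ D z -> bijective (Phi z) /\ is_ball_iso M c_st (c i z) (Phi z).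
  move=> nD; have /ball_iso_sym[phi iso] : ball_iso M (c i z) c_st.
    by apply: contrapT.
  have := is_ball_iso_extend iso; rewrite (_ : (fun v => _) = Phi z)//.
  apply/funext => v; rewrite /Phi; case: (asboolP (D z)) => // _.
  case: asboolP => // Mv; have [_ phi1 _ _] := iso.
  by rewrite -[in RHS]phi1 (develop_ball_iso iso (cball1 0) Mv) ?mulg1// add0n.
have bPhi z : bijective (Phi z).
  have [Dz|/PhiE[]//] := pselect (D z).
  by exists id => v; rewrite /Phi; case: asboolP.
have mPhi v w : measurable [set z | Phi z v = w].
  rewrite (_ : mkset _ = (D `&` [set z | v = w]) `|`
    (([set z | develop (c i z) 1%g v = w] `&` [set z | cball M v] `|`
      [set z | ~ cball M v /\ v = w]) `\` D)).
    apply: measurableU.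
      by apply: measurableI => //; exact: measurable_const_event.
    apply: measurableD => //; apply: measurableU; last exact: measurable_const_event.
    apply: measurableI; first exact: measurable_develop.
    exact: measurable_const_event.
  apply/seteqP; split => z; rewrite /Phi /setU /setI /setD /=;
    case: (asboolP (D z)) => Dz; case: (asboolP (cball M v)) => Mv; tauto.
have isoD z : ~ D z -> is_ball_iso r c_st (c i z) (Phi z).
  by move=> /PhiE[_ iso]; exact: is_ball_iso_restrict iso (leq_addr _ _).
have rhoD z u t y : ~ D z -> cball r u ->
    rho t (cube_comp (develop (c i z) (Phi z u)) y) =
    rho t (cube_comp (fun g => Phi z (g * u)%g) y).
  move=> /PhiE[_ iso] ru; apply: nrho => g ng.
  by rewrite /cube_comp (develop_ball_iso iso ru ng).
have rhoF' s : lam [set y | rho (root_site c_st s) (cube_comp (fun g => (g * (val s).1)%g) y)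
    <> F y s] <= (eps / 2 / N%:R)%:E.
  apply: rule_error => //; apply: rhoF; apply: mem_ball_sites; first exact: cball1.
  have := valP (root_site c_st s).
  rewrite [val _]surjective_pairing [(val (root_site c_st s)).1]/=.
  have [<- _|ne /site_adj/(_ ne) h] := eqVneq 1%g (val (root_site c_st s)).2.
    exact: cball1.
  exact: (cball_step (cball1 0) h).
rewrite /tv_dist; apply: ge_ereal_sup => _ [C _ <-].
apply: le_trans (transfer_stats mc mrho lamP mF mD bPhi mPhi isoD rhoD rhoF' C) _.
rewrite [leRHS](_ : _ = (eps / 2)%:E + (eps / 2)%:E); last by rewrite -EFinD -splitr.
apply: leeD => //; rewrite lee_fin mulrCA ger_pMr// ler_pdivrMr ?ltr0n// mul1r.
by rewrite ler_nat leqnSn.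
Qed.

End FromDiagrams.

(** As a constant labelling, the standard diagram itself can be put in place of F
    in the first statement of each equivalence. *)
Let standard : cube R Gam -> labelling Gam Edges (gens Gam) := fun=> c_st.

(** Right translations do not change the quotient of two endpoints. *)
Lemma fiid_standard : fiid lam (@GammaK Gam) standard.
Proof.
split.
  apply: measurable_labellingP => s a.
  exact: (@measurable_const_event _ (cube R Gam) (c_st s = a)).
move=> _ [g _ <-]; apply: aeW => x; apply/funext => s; apply: val_inj.
by rewrite /lab_act /= invgM mulgA mulgK.
Qed.

Lemma standard_stats r (F : cube R Gam -> labelling Gam Edges (gens Gam)) :
  measurable_labelling F ->
  `|local_stats lam r standard [set iso_class r c_st] -
    local_stats lam r F [set iso_class r c_st]| =
  1 - lam [set x | ball_iso r (F x) c_st].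
Proof.
move=> mF; have mB := measurable_ball_iso r c_st mF.
rewrite /local_stats [X in lam X - _](_ : _ = setT); last by apply/seteqP; split.
rewrite [X in _ - lam X](_ : _ = [set x | ball_iso r (F x) c_st]); last first.
  by apply/seteqP; split => x /= /iso_classP.
by rewrite probability_setT gee0_abs// sube_ge0 ?probability_le1// fin_num_measure.
Qed.

(** Equal statistics force all balls at the root to be standard, and the balls at
    the root see the whole graph. *)
Lemma diagram_of_stats :
  (exists F', fiid lam (@AutK Gam) F' /\ same_local_stats lam standard F') ->
  has_fiid_cayley_diagram lam.
Proof.
move=> [c [cfiid same]]; exists c; split => //; have [mc _] := cfiid.
have /ae_foralln : forall r, {ae lam, forall x, ball_iso r (c x) c_st}.
  move=> r; have mB := measurable_ball_iso r c_st mc.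
  exists (~` [set x | ball_iso r (c x) c_st]); split => //; first exact: measurableC.
  have stats := standard_stats r mc; rewrite -(same r) subee in stats.
    by rewrite probability_setC// -stats abse0.
  by rewrite fin_num_measure//; apply: measurable_iso_class; have [] := fiid_standard.
by apply: filterS => x balls; exact: cayley_diagram_of_balls.
Qed.

(** The diagonal sequence: the i-th labelling matches the standard diagram at
    radius i up to 1 / (i + 1), hence at every radius below i as well. *)
Lemma approx_diagram_of_stats :
  (forall (r : nat) (eps : R), (0 < eps)%R -> exists F',
    fiid lam (@AutK Gam) F' /\
    tv_dist (local_stats lam r standard) (local_stats lam r F') <= eps%:E) ->
  has_fiid_approx_cayley_diagram lam.
Proof.
move=> approx.
have /choice[c cP] (i : nat) : exists c, fiid lam (@AutK Gam) c /\
    (1 - i.+1%:R^-1)%:E <= lam [set x | ball_iso i (c x) c_st].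
  have [|c [cfiid tv]] := approx i (i.+1%:R^-1)%R; first by rewrite invr_gt0 ltr0n.
  exists c; split => //; have [mc _] := cfiid.
  have : 1 - lam [set x | ball_iso i (c x) c_st] <= (i.+1%:R^-1)%:E.
    rewrite -(standard_stats i mc); apply: le_trans tv; apply: ereal_sup_ubound.
    by exists [set iso_class i c_st].
  have mB := measurable_ball_iso i c_st mc.
  rewrite EFinB leeBlDr ?fin_num_measure// => h.
  by rewrite leeBlDl.
exists c; split=> [i|r]; first by have [] := cP i.
have lower : (fun i => (1 - i.+1%:R^-1)%:E) @ \oo --> (1 : \bar R).
  apply: cvg_EFin; first by apply: nearW.
  rewrite -[X in _ --> X]subr0; apply: cvgB; first exact: cvg_cst.
  exact: cvg_harmonic.
apply: (squeeze_cvge _ lower (cvg_cst _)).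
near=> i; have [[mc _] ci] := cP i; apply/andP; split.
  apply: le_trans ci _; apply: le_measure; rewrite ?inE.
  - exact: measurable_ball_iso.
  - exact: measurable_ball_iso.
  - by move=> x /=; apply: ball_iso_mono; near: i; exact: nbhs_infty_ge.
by apply: probability_le1; exact: measurable_ball_iso.
Unshelve. all: by end_near.
Qed.
End Main.

Local Open Scope ereal_scope.

Theorem theorem1p4 (R : realType) (Gam : markedGroup)
    (lam : probability (cube R Gam) R) (lamP : is_product_lebesgue lam) :
  ((forall (k : label_kind) (A : finType) (F : cube R Gam -> labelling Gam k A),
      fiid lam (@GammaK Gam) F ->
      exists F' : cube R Gam -> labelling Gam k A,
        fiid lam (@AutK Gam) F' /\ same_local_stats lam F F')
   <-> has_fiid_cayley_diagram lam)
  /\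
  ((forall (k : label_kind) (A : finType) (F : cube R Gam -> labelling Gam k A),
      fiid lam (@GammaK Gam) F ->
      forall (r : nat) (eps : R), (0 < eps)%R ->
      exists F' : cube R Gam -> labelling Gam k A,
        fiid lam (@AutK Gam) F' /\
        tv_dist (local_stats lam r F) (local_stats lam r F') <= eps%:E)
   <-> has_fiid_approx_cayley_diagram lam).
Proof.
split; split.
- by move=> /(_ _ _ _ (fiid_standard lam)); exact: diagram_of_stats.
- by move=> cd k A F FP; exact: diagram_stats.
- move=> approx; apply: approx_diagram_of_stats; exact: approx (fiid_standard lam).
- by move=> cd k A F FP; exact: approx_diagram_stats.
Qed.
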